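(* Let $N$ be a unipotent algebraic group over $\mathbb{Q}$, $p$ a prime, $\Gamma\subseteq N(\mathbb{Q})$ a congruence subgroup with closure $K_p\subseteq N(\mathbb{Q}_p)$, and $V$ a smooth $K_p$-representation over $\mathbb{F}_p$. Then the natural map $H^i_{cts}(K_p,V)\to H^i(\Gamma,V)$ is an isomorphism for all $i$.
   Context: A congruence subgroup of $N(\mathbb{Q})$ is a subgroup of the form $N(\mathbb{Q})\cap K$ for a compact open $K\subseteq N(\mathbb{A}_f)$. A smooth representation is one in which every vector has open stabilizer; $H^i_{cts}$ is continuous group cohomology and $H^i(\Gamma,-)$ is (discrete) group cohomology. *)

(* Defs.v *)
From HB Require Import structures.
From mathcomp Require Import all_boot all_order all_algebra all_field.
From mathcomp Require Import all_classical.
From mathcomp Require Import topology.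
From mathcomp Require mpoly.
Set Implicit Arguments.
Unset Strict Implicit.
Unset Printing Implicit Defensive.
Import Order.TTheory GRing.Theory Num.Theory.
Import Quotient.

Local Open Scope classical_set_scope.
Local Open Scope ring_scope.

Definition prime_number := {p : nat | prime p}.
Definition nat_of_prime (p : prime_number) : nat := val p.
Coercion nat_of_prime : prime_number >-> nat.

Section ClassicalInverse.
Variable R : comNzRingType.

Definition has_inverse : {pred R} := fun x => `[< exists y, y * x = 1 >].

Definition classical_inv (x : R) : R := xget x [set y | y * x = 1].

Lemma classical_mulVx : {in has_inverse, left_inverse 1 classical_inv *%R}.
Proof.
by move=> x /asboolP ex; exact: (@xgetPex _ x [set y | y * x = 1]).
Qed.

Lemma classical_unitPl (x y : R) : y * x = 1 -> has_inverse x.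
Proof. by move=> yx; apply/asboolP; exists y. Qed.

Lemma classical_inv_out : {in [predC has_inverse], classical_inv =1 id}.
Proof.
move=> x /negP Nx; rewrite /classical_inv; case: xgetP => // y _ yx.
by case: Nx; apply: classical_unitPl yx.
Qed.

End ClassicalInverse.

Lemma modz_dvdm (m d d' : int) : (d %| d')%Z -> ((m %% d')%Z = m %[mod d])%Z.
Proof.
move=> dd'; apply/eqP; rewrite eq_sym eqz_mod_dvd {1}(divz_eq m d') addrK.
by rewrite dvdz_mull.
Qed.

Section PadicInt.
Variable p : prime_number.

(* [x n] is the representative in [[0, p^n[] of the component in Z/p^n *)
Definition padic_coherent : pred (nat -> int) :=
  fun x => `[< forall n, x n = (x n.+1 %% (p%:Z ^+ n))%Z >].

Record padic_int := PadicInt {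
  padic_seq :> nat -> int;
  _ : padic_coherent padic_seq }.

HB.instance Definition _ := [isSub for padic_seq].
HB.instance Definition _ := [Choice of padic_int by <:].

Lemma padic_seqP (x : padic_int) n :
  (x n.+1 = x n %[mod p%:Z ^+ n])%Z.
Proof.
by case: x => x /= /asboolP xP; rewrite [in RHS]xP modz_mod.
Qed.

Lemma padic_seq_mod (x : padic_int) n : (x n %% p%:Z ^+ n)%Z = x n.
Proof. by case: x => x /= /asboolP ->; rewrite modz_mod. Qed.

Lemma padic_of_seq_subproof (x : nat -> int) :
  (forall n, (x n.+1 = x n %[mod p%:Z ^+ n])%Z) ->
  padic_coherent (fun n => (x n %% p%:Z ^+ n)%Z).
Proof.
move=> xP; apply/asboolP => n.
by rewrite modz_dvdm ?exprS ?dvdz_mull// xP.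
Qed.

Definition padic_of_seq x xP := PadicInt (@padic_of_seq_subproof x xP).

Lemma padic_eqP (x y : padic_int) :
  (forall n, (x n = y n %[mod p%:Z ^+ n])%Z) -> x = y.
Proof.
move=> xy; apply/val_inj/funext => n /=.
by rewrite -[LHS]padic_seq_mod xy padic_seq_mod.
Qed.

Lemma padic_const_subproof (c : int) n :
  (c = c %[mod p%:Z ^+ n])%Z.
Proof. by []. Qed.

Lemma padic_opp_subproof (x : padic_int) n :
  (- x n.+1 = - x n %[mod p%:Z ^+ n])%Z.
Proof. by rewrite -modzNm padic_seqP modzNm. Qed.

Lemma padic_add_subproof (x y : padic_int) n :
  (x n.+1 + y n.+1 = x n + y n %[mod p%:Z ^+ n])%Z.
Proof. by rewrite -modzDm !padic_seqP modzDm. Qed.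

Lemma padic_mul_subproof (x y : padic_int) n :
  (x n.+1 * y n.+1 = x n * y n %[mod p%:Z ^+ n])%Z.
Proof. by rewrite -modzMm !padic_seqP modzMm. Qed.

Definition padic_const c := padic_of_seq (padic_const_subproof c).
Definition padic_opp x := padic_of_seq (padic_opp_subproof x).
Definition padic_add x y := padic_of_seq (padic_add_subproof x y).
Definition padic_mul x y := padic_of_seq (padic_mul_subproof x y).

Lemma padic_addA : associative padic_add.
Proof.
by move=> x y z; apply: padic_eqP => n /=; rewrite !(modzDml, modzDmr, modz_mod) addrA.
Qed.

Lemma padic_addC : commutative padic_add.
Proof. by move=> x y; apply: padic_eqP => n /=; rewrite addrC. Qed.

Lemma padic_add0 : left_id (padic_const 0) padic_add.
Proof. by move=> x; apply: padic_eqP => n /=; rewrite modzDml add0r modz_mod. Qed.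

Lemma padic_addN : left_inverse (padic_const 0) padic_opp padic_add.
Proof. by move=> x; apply: padic_eqP => n /=; rewrite modzDml addNr modz_mod. Qed.

HB.instance Definition _ := GRing.isZmodule.Build padic_int
  padic_addA padic_addC padic_add0 padic_addN.

Lemma padic_mulA : associative padic_mul.
Proof.
by move=> x y z; apply: padic_eqP => n /=; rewrite !(modzMml, modzMmr, modz_mod) mulrA.
Qed.

Lemma padic_mulC : commutative padic_mul.
Proof. by move=> x y; apply: padic_eqP => n /=; rewrite mulrC. Qed.

Lemma padic_mul1 : left_id (padic_const 1) padic_mul.
Proof. by move=> x; apply: padic_eqP => n /=; rewrite modzMml mul1r modz_mod. Qed.

Lemma padic_mulDl : left_distributive padic_mul padic_add.
Proof.
move=> x y z; apply: padic_eqP => n /=.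
by rewrite !(modzMml, modzMmr, modzDml, modzDmr, modz_mod) mulrDl.
Qed.

Lemma padic_oner_neq0 : padic_const 1 != padic_const 0.
Proof.
apply/eqP => /(congr1 (fun x : padic_int => x 1%N)) /=.
by rewrite expr1 mod0z modz_small// ltz_nat prime_gt1//; exact: valP p.
Qed.

HB.instance Definition _ := GRing.Zmodule_isComNzRing.Build padic_int
  padic_mulA padic_mulC padic_mul1 padic_mulDl padic_oner_neq0.

HB.instance Definition _ := GRing.ComNzRing_hasMulInverse.Build padic_int
  (@classical_mulVx padic_int) (@classical_unitPl padic_int)
  (@classical_inv_out padic_int).

Lemma padic_natE (m n : nat) :
  (m%:R : padic_int) n = (m%:Z %% p%:Z ^+ n)%Z.
Proof.
elim: m => [|m IHm]; first by [].
by rewrite -addn1 natrD /= IHm modzDml modzDmr PoszD.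
Qed.

Lemma padic_stable (x : padic_int) k n : (k <= n)%N ->
  (x n = x k %[mod p%:Z ^+ k])%Z.
Proof.
move=> /subnK <-; elim: (n - k)%N => [//|m <-].
have kmk : (p%:Z ^+ k %| p%:Z ^+ (m + k))%Z by rewrite exprD dvdz_mull.
by rewrite addSn -(modz_dvdm _ kmk) padic_seqP (modz_dvdm _ kmk).
Qed.

Lemma padic_neq0P (x : padic_int) :
  x != 0 -> exists k, forall n, (k <= n)%N -> ~~ (p%:Z ^+ k %| x n)%Z.
Proof.
move=> /eqP x0; apply: contrapT => /forallNP nx; apply: x0.
apply: padic_eqP => k; rewrite /= !mod0z; apply: contrapT => xk.
by apply: (nx k) => n kn; apply/dvdz_mod0P; rewrite padic_stable.
Qed.

Lemma prime_Xdvdz_mul (k m : nat) (a b : int) :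
  (p%:Z ^+ (k + m) %| a * b)%Z -> (p%:Z ^+ k %| a)%Z || (p%:Z ^+ m %| b)%Z.
Proof.
have p_pr : prime p := valP p.
rewrite !dvdzE !abszX /= abszM.
have [->|a0] := posnP `|a|%N; first by rewrite dvdn0.
have [->|b0] := posnP `|b|%N; first by rewrite dvdn0 orbT.
rewrite !pfactor_dvdn ?muln_gt0 ?a0// lognM//.
case: (leqP k) => //= ka; case: (leqP m) => // mb.
by rewrite leqNgt -addSn leq_add // ltnW.
Qed.

Lemma padic_mulf_eq0 : GRing.integral_domain_axiom padic_int.
Proof.
move=> x y xy0; apply/norP => -[] /padic_neq0P[k xk] /padic_neq0P[m ym].
have /(congr1 (fun z : padic_int => z (k + m)%N)) /= := xy0.
rewrite mod0z => /dvdz_mod0P /prime_Xdvdz_mul /orP[].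
- by apply/negP/xk/leq_addr.
- by apply/negP/ym/leq_addl.
Qed.

HB.instance Definition _ :=
  GRing.ComUnitRing_isIntegral.Build padic_int padic_mulf_eq0.

Lemma padic_int_natr_eq0 (m : nat) : (m%:R == 0 :> padic_int) = (m == 0%N).
Proof.
apply/idP/idP => [/eqP|/eqP->//].
move=> /(congr1 (fun x : padic_int => x m)); rewrite padic_natE /= mod0z.
rewrite modz_small => [[->]//|].
by rewrite -rmorphXn /= ltz_nat ltn_expl// prime_gt1//; exact: valP p.
Qed.

End PadicInt.

Section RatrChar0.
Variable F : fieldType.
Hypothesis F0 : forall m : nat, (m%:R == 0 :> F) = (m == 0%N).

Lemma denq_char0_neq0 (x : rat) : (denq x)%:~R != 0 :> F.
Proof. by rewrite -absz_denq -pmulrn F0 absz_eq0 denq_eq0. Qed.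

Lemma ratr_char0_zmod_morphism : zmod_morphism (@ratr F).
Proof.
have injZtoQ : @injective rat int intr by apply: intr_inj.
have nz_den := denq_char0_neq0.
move=> x y.
apply: (canLR (mulfK (nz_den _))); apply: (mulIf (nz_den x)).
rewrite mulrAC mulrBl divfK ?nz_den // mulrAC -!rmorphM.
apply: (mulIf (nz_den y)); rewrite mulrAC mulrBl divfK ?nz_den //.
rewrite -!(rmorphM, rmorphB); congr _%:~R; apply: injZtoQ.
rewrite !(rmorphM, rmorphB) /= [_ - _]lock /= -lock !numqE.
by rewrite (mulrAC y) -!mulrBl -mulrA mulrAC !mulrA.
Qed.

Lemma ratr_char0_monoid_morphism : monoid_morphism (@ratr F).
Proof.
have injZtoQ : @injective rat int intr by apply: intr_inj.
have nz_den := denq_char0_neq0.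
split=> [|x y]; first by rewrite /ratr divr1.
rewrite /ratr mulrC mulrAC; apply: canLR (mulKf (nz_den _)) _; rewrite !mulrA.
do 2!apply: canRL (mulfK (nz_den _)) _; rewrite -!rmorphM; congr _%:~R.
apply: injZtoQ; rewrite !rmorphM [x * y]lock /= !numqE -lock.
by rewrite -!mulrA mulrA mulrCA -!mulrA (mulrCA y).
Qed.

End RatrChar0.

HB.structure Definition PreTopologicalComUnitRing :=
  {R of GRing.ComUnitRing R & Topological R}.
Notation topComUnitRingType := PreTopologicalComUnitRing.type.

Section Padic.
Variable p : prime_number.

Definition padic : Type := {fraction (padic_int p)}.
HB.instance Definition _ := GRing.Field.on padic.

Definition padic_integers : set padic := range (@FracField.tofrac (padic_int p)).

Lemma padic_natr_eq0 (m : nat) : (m%:R == 0 :> padic) = (m == 0%N).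
Proof.
by rewrite -(rmorph_nat (@FracField.tofrac (padic_int p))) tofrac_eq0
  padic_int_natr_eq0.
Qed.

Definition rat_to_padic : rat -> padic := @ratr padic.

HB.instance Definition _ := GRing.isZmodMorphism.Build rat padic rat_to_padic
  (ratr_char0_zmod_morphism padic_natr_eq0).
HB.instance Definition _ := GRing.isMonoidMorphism.Build rat padic rat_to_padic
  (ratr_char0_monoid_morphism padic_natr_eq0).

Lemma padic_integers0 : padic_integers 0.
Proof. by exists 0 => //; rewrite rmorph0. Qed.

Lemma padic_integers1 : padic_integers 1.
Proof. by exists 1 => //; rewrite rmorph1. Qed.

Lemma padic_integersN x : padic_integers x -> padic_integers (- x).
Proof. by move=> [a _ <-]; exists (- a) => //; rewrite rmorphN. Qed.

Lemma padic_integersD x y :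
  padic_integers x -> padic_integers y -> padic_integers (x + y).
Proof. by move=> [a _ <-] [b _ <-]; exists (a + b) => //; rewrite rmorphD. Qed.

Lemma padic_integersM x y :
  padic_integers x -> padic_integers y -> padic_integers (x * y).
Proof. by move=> [a _ <-] [b _ <-]; exists (a * b) => //; rewrite rmorphM. Qed.

Lemma padic_integersX x k : padic_integers x -> padic_integers (x ^+ k).
Proof.
move=> xZ; elim: k => [|k IHk]; first exact: padic_integers1.
by rewrite exprS; exact: padic_integersM.
Qed.

Lemma padic_integers_nat m : padic_integers m%:R.
Proof. by exists m%:R => //; rewrite rmorph_nat. Qed.

Lemma padic_integers_int (m : int) : padic_integers m%:~R.
Proof.
case: m => m; first exact: padic_integers_nat.
by rewrite NegzE rmorphN; apply: padic_integersN; exact: padic_integers_nat.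
Qed.

(* the sets [x + p ^ k Z_p] are a base of neighbourhoods of [x] *)
Definition padic_open : set_system padic := fun U => forall x, U x ->
  exists k : nat, forall z, padic_integers z -> U (x + p%:R ^+ k * z).

Lemma padic_openT : padic_open setT.
Proof. by move=> x _; exists 0%N. Qed.

Lemma padic_openI : setI_closed padic_open.
Proof.
move=> U V oU oV x [Ux Vx].
have [k Uk] := oU x Ux; have [m Vm] := oV x Vx; exists (k + m)%N => z zZ.
have pZ j : padic_integers (p%:R ^+ j * z).
  by apply: padic_integersM => //; apply/padic_integersX/padic_integers_nat.
split; first by rewrite exprD -mulrA; exact: Uk.
by rewrite addnC exprD -mulrA; exact: Vm.
Qed.

Lemma padic_open_bigU (I : Type) (f : I -> set padic) :
  (forall i, padic_open (f i)) -> padic_open (\bigcup_i f i).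
Proof.
by move=> of_ x [i _ fix_]; have [k fk] := of_ i x fix_; exists k => z zZ;
  exists i => //; exact: fk.
Qed.

HB.instance Definition _ :=
  isOpenTopological.Build padic padic_openT padic_openI padic_open_bigU.

Lemma open_padicE : open = padic_open.
Proof. by []. Qed.

Lemma open_padic_integers : open padic_integers.
Proof.
move=> x xZ; exists 0%N => z zZ.
by rewrite expr0 mul1r; exact: padic_integersD.
Qed.

Lemma padic_int_coprime_unit (m : nat) : coprime p m ->
  exists y : padic_int p, y * m%:R = 1.
Proof.
move=> pm.
have /choice[u uP] (k : nat) : exists u : int,
    (u * m%:Z = 1 %[mod p%:Z ^+ k])%Z.
  have /coprimezP[[u v] /= uv] : coprimez m%:Z (p%:Z ^+ k).
    by rewrite -rmorphXn /= coprimezE /= coprime_sym coprimeXl.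
  by exists u; rewrite -uv addrC modzMDl.
have u_coh k : (u k.+1 = u k %[mod p%:Z ^+ k])%Z.
  have uP' : (u k.+1 * m%:Z = 1 %[mod p%:Z ^+ k])%Z.
    have pk : (p%:Z ^+ k %| p%:Z ^+ k.+1)%Z by rewrite exprS dvdz_mull.
    by rewrite -[LHS](modz_dvdm _ pk) uP (modz_dvdm _ pk).
  rewrite -[u k.+1]mulr1 -modzMmr -(uP k) modzMmr mulrCA -modzMmr.
  by rewrite uP' modzMmr mulr1.
exists (padic_of_seq u_coh); apply: padic_eqP => k /=.
by rewrite padic_natE !(modzMml, modzMmr, modz_mod) uP.
Qed.

Lemma rat_to_padic_integers (q : rat) :
  ~~ (p %| `|denq q|)%N -> padic_integers (rat_to_padic q).
Proof.
rewrite -prime_coprime; last exact: valP p.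
move=> /padic_int_coprime_unit[y yd]; rewrite /rat_to_padic /ratr.
apply: padic_integersM; first exact: padic_integers_int.
exists y => //; rewrite -[in RHS]absz_denq -pmulrn.
have /(congr1 (@FracField.tofrac (padic_int p))) := yd.
rewrite rmorphM rmorph1 rmorph_nat => yd1.
have d0 : `|denq q|%:R != 0 :> padic.
  by apply: contra_eq_neq yd1 => ->; rewrite mulr0 eq_sym oner_eq0.
by apply: (mulIf d0); rewrite yd1 mulVf.
Qed.

End Padic.

Definition adele_pred : pred (forall p : prime_number, padic p) :=
  fun x => `[< finite_set [set p | ~ padic_integers (x p)] >].

Record adele := Adele {
  adele_comp :> forall p : prime_number, padic p;
  _ : adele_pred adele_comp }.

HB.instance Definition _ := [isSub for adele_comp].
HB.instance Definition _ := [Choice of adele by <:].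

Lemma adeleP (x : adele) : finite_set [set p | ~ padic_integers (x p)].
Proof. by case: x => x /= /asboolP. Qed.

Lemma adele_eqP (x y : adele) : (forall p, x p = y p) -> x = y.
Proof. by move=> xy; apply/val_inj/functional_extensionality_dep. Qed.

Lemma adele_pred_all x : (forall p, padic_integers (x p)) -> adele_pred x.
Proof.
by move=> xZ; apply/asboolP; apply: sub_finite_set (finite_set0 _) => p /(_ (xZ p)).
Qed.

Lemma adele_pred_opp (x : adele) : adele_pred (fun p => - x p).
Proof.
apply/asboolP; apply: sub_finite_set (adeleP x) => p /= + xp; apply.
exact: padic_integersN.
Qed.

Lemma adele_pred_op2 (op : forall p, padic p -> padic p -> padic p)
    (x y : adele) :
  (forall p a b, padic_integers a -> padic_integers b ->
     padic_integers (op p a b)) ->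
  adele_pred (fun p => op p (x p) (y p)).
Proof.
move=> opZ; apply/asboolP.
apply: (@sub_finite_set _ _ ([set p | ~ padic_integers (x p)] `|`
                             [set p | ~ padic_integers (y p)])); last first.
  by rewrite finite_setU; split; exact: adeleP.
move=> p /= xyp; apply: contrapT => /not_orP[/contrapT xp /contrapT yp].
by apply: xyp; exact: opZ.
Qed.

Definition adele0 := Adele (adele_pred_all (fun p => padic_integers0 p)).
Definition adele1 := Adele (adele_pred_all (fun p => padic_integers1 p)).
Definition adele_opp x := Adele (adele_pred_opp x).
Definition adele_add (x y : adele) :=
  Adele (adele_pred_op2 x y (fun p => @padic_integersD p)).
Definition adele_mul (x y : adele) :=
  Adele (adele_pred_op2 x y (fun p => @padic_integersM p)).

Lemma adele_addA : associative adele_add.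
Proof. by move=> x y z; apply: adele_eqP => p /=; rewrite addrA. Qed.
Lemma adele_addC : commutative adele_add.
Proof. by move=> x y; apply: adele_eqP => p /=; rewrite addrC. Qed.
Lemma adele_add0 : left_id adele0 adele_add.
Proof. by move=> x; apply: adele_eqP => p /=; rewrite add0r. Qed.
Lemma adele_addN : left_inverse adele0 adele_opp adele_add.
Proof. by move=> x; apply: adele_eqP => p /=; rewrite addNr. Qed.

HB.instance Definition _ :=
  GRing.isZmodule.Build adele adele_addA adele_addC adele_add0 adele_addN.

Lemma adele_mulA : associative adele_mul.
Proof. by move=> x y z; apply: adele_eqP => p /=; rewrite mulrA. Qed.
Lemma adele_mulC : commutative adele_mul.
Proof. by move=> x y; apply: adele_eqP => p /=; rewrite mulrC. Qed.
Lemma adele_mul1 : left_id adele1 adele_mul.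
Proof. by move=> x; apply: adele_eqP => p /=; rewrite mul1r. Qed.
Lemma adele_mulDl : left_distributive adele_mul adele_add.
Proof. by move=> x y z; apply: adele_eqP => p /=; rewrite mulrDl. Qed.
Lemma adele_oner_neq0 : adele1 != adele0.
Proof.
apply/eqP => /(congr1 (fun x : adele => x (exist _ 2%N isT))) /= /eqP.
by rewrite oner_eq0.
Qed.

HB.instance Definition _ := GRing.Zmodule_isComNzRing.Build adele
  adele_mulA adele_mulC adele_mul1 adele_mulDl adele_oner_neq0.

HB.instance Definition _ := GRing.ComNzRing_hasMulInverse.Build adele
  (@classical_mulVx adele) (@classical_unitPl adele)
  (@classical_inv_out adele).

Definition adele_open : set_system adele := fun U => forall x, U x ->
  exists W : forall p, set (padic p),
  [/\ forall p, open (W p), finite_set [set p | W p <> padic_integers (p := p)],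
      forall p, W p (x p) & forall y : adele, (forall p, W p (y p)) -> U y].

Lemma adele_openT : adele_open setT.
Proof.
move=> x _.
exists (fun p => if `[< padic_integers (x p) >] then padic_integers (p := p)
                 else setT); split => // [p||p].
- by case: ifPn => _; [exact: open_padic_integers|exact: openT].
- by apply: sub_finite_set (adeleP x) => p /= + xp; rewrite asboolT.
- by case: ifPn => // /asboolP.
Qed.

Lemma adele_openI : setI_closed adele_open.
Proof.
move=> U V oU oV x [Ux Vx].
have [W [oW fW Wx WU]] := oU x Ux; have [T [oT fT Tx TV]] := oV x Vx.
exists (fun p => W p `&` T p); split => [p||p|y WTy]; first exact: openI.
- apply: (@sub_finite_set _ _ ([set p | W p <> @padic_integers p] `|`
                               [set p | T p <> @padic_integers p])).
    move=> p /= WT; apply: contrapT => /not_orP[/contrapT Wp /contrapT Tp].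
    by apply: WT; rewrite Wp Tp setIid.
  by rewrite finite_setU.
- by split.
- by split; [apply: WU => p; have [] := WTy p|apply: TV => p; have [] := WTy p].
Qed.

Lemma adele_open_bigU (I : Type) (f : I -> set adele) :
  (forall i, adele_open (f i)) -> adele_open (\bigcup_i f i).
Proof.
move=> of_ x [i _ fix_]; have [W [oW fW Wx Wf]] := of_ i x fix_.
by exists W; split => // y Wy; exists i => //; exact: Wf.
Qed.

HB.instance Definition _ :=
  isOpenTopological.Build adele adele_openT adele_openI adele_open_bigU.

Lemma rat_to_adele_subproof (q : rat) :
  adele_pred (fun p => rat_to_padic p q).
Proof.
apply/asboolP; set d := `|denq q|%N.
have d0 : (0 < d)%N by rewrite absz_gt0 denq_eq0.
apply: (@sub_finite_set _ _ (nat_of_prime @^-1` `I_d.+1)).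
  move=> p /= Nq; rewrite ltnS; apply: dvdn_leq => //.
  by apply/negPn/negP => /rat_to_padic_integers.
by apply: finite_preimage; [move=> ? ? _ _; exact: val_inj|exact: finite_II].
Qed.

Definition rat_to_adele (q : rat) : adele := Adele (rat_to_adele_subproof q).

Lemma rat_to_adele_zmod_morphism : zmod_morphism rat_to_adele.
Proof. by move=> x y; apply: adele_eqP => p /=; rewrite rmorphB. Qed.

Lemma rat_to_adele_monoid_morphism : monoid_morphism rat_to_adele.
Proof.
split; first by apply: adele_eqP => p /=; rewrite rmorph1.
by move=> x y; apply: adele_eqP => p /=; rewrite rmorphM.
Qed.

HB.instance Definition _ := GRing.isZmodMorphism.Build rat adele rat_to_adele
  rat_to_adele_zmod_morphism.
HB.instance Definition _ := GRing.isMonoidMorphism.Build rat adele rat_to_adele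
  rat_to_adele_monoid_morphism.

#[short(type="preTopologicalGroupType")]
HB.structure Definition PreTopologicalGroup :=
  {G of Group G & Topological G}.

Section GL.
Variables (n : nat) (R : comUnitRingType).

Record GL := MkGL { GL_mx :> 'M[R]_n; _ : GL_mx \in unitmx }.

HB.instance Definition _ := [isSub for GL_mx].
HB.instance Definition _ := [Choice of GL by <:].

Lemma GL_unitmx (g : GL) : (g : 'M[R]_n) \in unitmx.
Proof. by case: g. Qed.

Definition GL_one := MkGL (unitmx1 R n).

Lemma GL_mul_subproof (g h : GL) : (g : 'M[R]_n) *m h \in unitmx.
Proof. by rewrite unitmx_mul !GL_unitmx. Qed.

Definition GL_mul g h := MkGL (GL_mul_subproof g h).

Lemma GL_inv_subproof (g : GL) : invmx (g : 'M[R]_n) \in unitmx.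
Proof. by rewrite unitmx_inv GL_unitmx. Qed.

Definition GL_inv g := MkGL (GL_inv_subproof g).

Lemma GL_mulA : associative GL_mul.
Proof. by move=> x y z; apply: val_inj; exact: mulmxA. Qed.
Lemma GL_mul1 : left_id GL_one GL_mul.
Proof. by move=> x; apply: val_inj; exact: mul1mx. Qed.
Lemma GL_mulr1 : right_id GL_one GL_mul.
Proof. by move=> x; apply: val_inj; exact: mulmx1. Qed.
Lemma GL_mulV : left_inverse GL_one GL_inv GL_mul.
Proof. by move=> x; apply/val_inj/mulVmx/GL_unitmx. Qed.
Lemma GL_mulrV : right_inverse GL_one GL_inv GL_mul.
Proof. by move=> x; apply/val_inj/mulmxV/GL_unitmx. Qed.

HB.instance Definition _ :=
  isGroup.Build GL GL_mulA GL_mul1 GL_mulr1 GL_mulV GL_mulrV.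

End GL.

(* the topology of [GL_n(R)] is induced by [g |-> (g, g^-1)]: for a general
   topological ring [R] inversion need not be continuous on [R^*] *)
HB.instance Definition _ (n : nat) (R : topComUnitRingType) :=
  Topological.copy (GL n R)
    (initial_topology
       (fun g : GL n R => (GL_mx g, GL_mx (g^-1)%g) : 'M[R]_n * 'M[R]_n)).

Section GLMap.
Variables (n : nat) (R S : comUnitRingType) (f : {rmorphism R -> S}).

Lemma GL_map_subproof (g : GL n R) : map_mx f g \in unitmx.
Proof. by rewrite unitmxE det_map_mx rmorph_unit// -unitmxE GL_unitmx. Qed.

Definition GL_map (g : GL n R) : GL n S := MkGL (GL_map_subproof g).

Lemma GL_mapM : {morph GL_map : g h / (g * h)%g}.
Proof. by move=> g h; apply: val_inj; exact: map_mxM. Qed.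

HB.instance Definition _ := isMultiplicative.Build (GL n R) (GL n S) GL_map GL_mapM.

End GLMap.

Record subgroup (G : groupType) := Subgroup {
  subgroup_set : set G;
  subgroup1 : subgroup_set 1%g;
  subgroupM : forall g h, subgroup_set g -> subgroup_set h -> subgroup_set (g * h)%g;
  subgroupV : forall g, subgroup_set g -> subgroup_set (g^-1)%g }.

Section SubgroupType.
Variables (G : groupType) (H : subgroup G).

Definition subgroup_type : Type := set_type (subgroup_set H).
HB.instance Definition _ := SubChoice.on subgroup_type.

Lemma subgroup_group_closed : group_closed (mem (subgroup_set H)).
Proof.
split; first by apply/mem_set; exact: subgroup1.
move=> g h /set_mem Hg /set_mem Hh; apply/mem_set/subgroupM => //.
exact: subgroupV.
Qed.

HB.instance Definition _ := SubChoice_isSubGroup.Build G _ subgroup_type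
  subgroup_group_closed.

End SubgroupType.

Coercion subgroup_type : subgroup >-> Sortclass.

HB.instance Definition _ (G : preTopologicalGroupType) (H : subgroup G) :=
  Topological.copy (subgroup_type H) (set_type (subgroup_set H)).

Section SubgroupMap.
Variables (G G' : groupType) (f : {multiplicative G -> G'}).
Variables (H : subgroup G) (H' : subgroup G').
Hypothesis fHH' : forall g, subgroup_set H g -> subgroup_set H' (f g).

Lemma subgroup_map_subproof (x : H) : f (val x) \in subgroup_set H'.
Proof. by apply/mem_set/fHH'/set_mem; exact: (valP x). Qed.

Definition subgroup_map (x : H) : H' := Sub (f (val x)) (subgroup_map_subproof x).

Lemma subgroup_mapM : {morph subgroup_map : x y / (x * y)%g}.
Proof. by move=> x y; apply: val_inj; rewrite /= gmulfM. Qed.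

HB.instance Definition _ := isMultiplicative.Build H H' subgroup_map subgroup_mapM.

End SubgroupMap.

Section AlgebraicGroup.
Variable n : nat.

(* value at the entries of [g] of a polynomial in [n * n] variables with
   rational coefficients; [f] is the structure map of the Q-algebra [R] *)
Definition entries_eval (R : comUnitRingType) (f : {rmorphism rat -> R})
    (g : 'M[R]_n) (q : mpoly.mpoly (n * n) rat) : R :=
  mpoly.mmap f (fun k => mxvec g 0 k) q.

Definition zero_locus (E : set (mpoly.mpoly (n * n) rat))
    (R : comUnitRingType) (f : {rmorphism rat -> R}) : set (GL n R) :=
  [set g | forall q, E q -> entries_eval f g q = 0].

(* a closed subgroup scheme of [GL_n] over Q, given by its equations: its
   points in every Q-algebra [R] form a subgroup of [GL_n(R)] *)
Record linear_algebraic_group := LinearAlgebraicGroup {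
  equations : set (mpoly.mpoly (n * n) rat);
  zero_locus1 : forall (R : comUnitRingType) (f : {rmorphism rat -> R}),
    zero_locus equations f 1%g;
  zero_locusM : forall (R : comUnitRingType) (f : {rmorphism rat -> R}) g h,
    zero_locus equations f g -> zero_locus equations f h ->
    zero_locus equations f (g * h)%g;
  zero_locusV : forall (R : comUnitRingType) (f : {rmorphism rat -> R}) g,
    zero_locus equations f g -> zero_locus equations f (g^-1)%g }.

Definition points (N : linear_algebraic_group) (R : comUnitRingType)
    (f : {rmorphism rat -> R}) : set (GL n R) := zero_locus (equations N) f.

(* every element of [N(Qbar)] is a unipotent matrix *)
Definition unipotent (N : linear_algebraic_group) : Prop :=
  forall g, points N (ratr : {rmorphism rat -> algC}) g ->
    exists k, (GL_mx g - 1%:M) ^+ k = 0.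

Lemma points_map (N : linear_algebraic_group) (R : comUnitRingType)
    (f : {rmorphism rat -> R}) (g : GL n rat) :
  points N (idfun : {rmorphism rat -> rat}) g -> points N f (GL_map f g).
Proof.
move=> Ng q Eq; have := Ng q Eq.
rewrite /entries_eval /= => /(congr1 f); rewrite rmorph0 => <-.
rewrite /mpoly.mmap rmorph_sum; apply: eq_bigr => m _.
rewrite rmorphM; congr (_ * _).
rewrite /mpoly.mmap1 rmorph_prod; apply: eq_bigr => k _.
by rewrite rmorphXn -map_mxvec mxE.
Qed.

Definition congruence_subgroup (N : linear_algebraic_group)
    (Gamma : subgroup (GL n rat)) : Prop :=
  exists K : subgroup (GL n adele),
  [/\ subgroup_set K `<=` points N rat_to_adele,
      compact (subgroup_set K),
      exists2 U : set (GL n adele), open U &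
        subgroup_set K = U `&` points N rat_to_adele
    & subgroup_set Gamma =
      [set g | points N (idfun : {rmorphism rat -> rat}) g /\
               subgroup_set K (GL_map rat_to_adele g)]].

Definition padic_closure (N : linear_algebraic_group)
    (Gamma : subgroup (GL n rat)) (p : prime_number) : set (GL n (padic p)) :=
  closure (GL_map (@rat_to_padic p) @` subgroup_set Gamma) `&` points N (@rat_to_padic p).

#[local] Arguments padic_closure : clear implicits.

Section ToClosure.
Variables (N : linear_algebraic_group) (Gamma : subgroup (GL n rat)).
Variables (p : prime_number) (K : subgroup (GL n (padic p))).
Hypothesis GammaN : congruence_subgroup N Gamma.
Hypothesis KE : subgroup_set K = padic_closure N Gamma p.

Lemma to_closure_subproof g :
  subgroup_set Gamma g -> subgroup_set K (GL_map (@rat_to_padic p) g).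
Proof.
move=> Gg; rewrite KE; split; first by apply: subset_closure; exists g.
apply: points_map; have [K' [_ _ _ GE]] := GammaN.
by move: Gg; rewrite GE => -[].
Qed.

Definition to_closure : {multiplicative Gamma -> K} :=
  subgroup_map to_closure_subproof.

End ToClosure.
End AlgebraicGroup.
Arguments padic_closure {n} N Gamma p.

Record representation (F : pzRingType) (G : groupType) (V : lmodType F) :=
  Representation {
    rep_act :> G -> {linear V -> V};
    rep_act1 : forall v, rep_act 1%g v = v;
    rep_actM : forall g h v, rep_act (g * h)%g v = rep_act g (rep_act h v) }.

Definition smooth (F : pzRingType) (G : preTopologicalGroupType)
    (V : lmodType F) (rho : representation G V) : Prop :=
  forall v, open [set g | rho g v = v].

Section PullbackRepresentation.
Variables (F : pzRingType) (G G' : groupType) (V : lmodType F).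
Variables (f : {multiplicative G' -> G}) (rho : representation G V).

Lemma pullback_act1 v : rho (f 1%g) v = v.
Proof.
have f1 : f 1%g = 1%g by apply: (mulIg (f 1%g)); rewrite -gmulfM !mul1g.
by rewrite f1 rep_act1.
Qed.

Lemma pullback_actM g h v : rho (f (g * h)%g) v = rho (f g) (rho (f h) v).
Proof. by rewrite gmulfM rep_actM. Qed.

Definition pullback_rep : representation G' V :=
  @Representation F G' V (fun g => rho (f g)) pullback_act1 pullback_actM.

End PullbackRepresentation.

Section Cochains.
Variables (F : pzRingType) (G : groupType) (V : lmodType F).

Definition cochain (i : nat) : Type := ('I_i.+1 -> G) -> V.
HB.instance Definition _ i := GRing.Zmodule.on (cochain i).

Lemma cochainBE i (c d : cochain i) g : (c - d) g = c g - d g.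
Proof. by []. Qed.

Definition coboundary (i : nat) (c : cochain i) : cochain i.+1 := fun g =>
  \sum_(j < i.+2) (-1) ^+ j *: c (fun k => g (lift j k)).

Lemma coboundaryB i : {morph @coboundary i : c d / c - d}.
Proof.
move=> c d; apply/funext => g; rewrite cochainBE /coboundary -sumrB.
by apply: eq_bigr => j _; rewrite cochainBE scalerBr.
Qed.

Lemma coboundary0 i : @coboundary i 0 = 0.
Proof. by rewrite -(subrr 0) coboundaryB subrr. Qed.

Definition equivariant (rho : representation G V) (i : nat) (c : cochain i) :=
  forall h g, c (fun k => h * g k)%g = rho h (c g).

(* a family of subgroups of the groups of cochains; a complex when it is
   stable under [coboundary] *)
Record cochain_family := CochainFamily {
  family_set :> forall i, set (cochain i);
  family0 : forall i, family_set (0 : cochain i);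
  familyB : forall i (c d : cochain i),
    @family_set i c -> @family_set i d -> @family_set i (c - d) }.
#[local] Arguments family_set : clear implicits.

Lemma equivariant0 rho i : @equivariant rho i 0.
Proof. by move=> h g; rewrite linear0. Qed.

Lemma equivariantB rho i (c d : cochain i) :
  equivariant rho c -> equivariant rho d -> equivariant rho (c - d).
Proof. by move=> ce de h g; rewrite !cochainBE ce de linearB. Qed.

Definition equivariant_cochains (rho : representation G V) : cochain_family :=
  CochainFamily (@equivariant0 rho) (@equivariantB rho).

Variable C : cochain_family.

Section Degree.
Variable i : nat.

Definition is_cocycle : {pred cochain i} :=
  fun c => `[< C i c /\ coboundary c = 0 >].

Lemma cocycle_zmod_closed : zmod_closed is_cocycle.
Proof.
split; first by apply/asboolP; split; [exact: family0|exact: coboundary0].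
move=> c d /asboolP[Cc c0] /asboolP[Cd d0]; apply/asboolP.
by split; [exact: familyB|rewrite coboundaryB c0 d0 subrr].
Qed.

HB.instance Definition _ :=
  GRing.isZmodClosed.Build (cochain i) is_cocycle cocycle_zmod_closed.

Record cocycle := Cocycle { cocycle_val :> cochain i; _ : cocycle_val \in is_cocycle }.
HB.instance Definition _ := [isSub for cocycle_val].
HB.instance Definition _ := [Choice of cocycle by <:].
HB.instance Definition _ := [SubChoice_isSubZmodule of cocycle by <:].

End Degree.

Definition is_coboundary (i : nat) : set (cochain i) :=
  match i with
  | 0 => [set 0]
  | j.+1 => [set coboundary c | c in C j]
  end.

Lemma is_coboundary0 i : is_coboundary (0 : cochain i).
Proof.
case: i => [//|j]; exists 0; [exact: family0|exact: coboundary0].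
Qed.

Lemma is_coboundaryB i (c d : cochain i) :
  is_coboundary c -> is_coboundary d -> is_coboundary (c - d).
Proof.
case: i c d => [|j] c d /=; first by move=> -> ->; rewrite subrr.
move=> [e Ce <-] [e' Ce' <-]; exists (e - e'); first exact: familyB.
exact: coboundaryB.
Qed.

Section Quotient.
Variable i : nat.

Definition is_coboundary_cocycle : {pred cocycle i} :=
  fun c => `[< is_coboundary (val c) >].

Lemma coboundary_zmod_closed : zmod_closed is_coboundary_cocycle.
Proof.
split => [|c d /asboolP cB /asboolP dB]; apply/asboolP.
  by rewrite raddf0; exact: is_coboundary0.
by rewrite raddfB; exact: is_coboundaryB.
Qed.

HB.instance Definition _ := GRing.isZmodClosed.Build (cocycle i)
  is_coboundary_cocycle coboundary_zmod_closed.

Definition cohomology : zmodType := {quot is_coboundary_cocycle}.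

Definition cohomology_class (c : cocycle i) : cohomology :=
  \pi_({quot is_coboundary_cocycle})%qT c.

Lemma cohomology_class_repr (x : cohomology) :
  exists c, x = cohomology_class c.
Proof. by exists (repr x); rewrite /cohomology_class reprK. Qed.

Lemma cohomology_class_eqP (c d : cocycle i) :
  cohomology_class c = cohomology_class d <->
  is_coboundary (val c - val d).
Proof.
rewrite -raddfB /=; split => [/eqP|cd].
  by rewrite -[X in is_true X]idealrBE => /asboolP.
by apply/eqP; rewrite -[X in is_true X]idealrBE; apply/asboolP.
Qed.

Lemma cohomology_classB : {morph cohomology_class : c d / c - d}.
Proof. by move=> c d; exact: (raddfB \pi_({quot is_coboundary_cocycle})%qT). Qed.

End Quotient.
End Cochains.

Section ContinuousCochains.
Variables (F : pzRingType) (G : preTopologicalGroupType) (V : lmodType F).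
Variable rho : representation G V.

(* [V] carries the discrete topology *)
Definition continuous_cochain (i : nat) (c : cochain G V i) : Prop :=
  continuous (c : {ptws 'I_i.+1 -> G} -> discrete_topology V).

Lemma continuous_cochain0 i : continuous_cochain (0 : cochain G V i).
Proof. exact: cst_continuous. Qed.

Lemma continuous_cochainB i (c d : cochain G V i) :
  continuous_cochain c -> continuous_cochain d -> continuous_cochain (c - d).
Proof.
move=> cc cd x A Ax.
have locst (e : cochain G V i) : continuous_cochain e ->
    nbhs (x : {ptws 'I_i.+1 -> G}) [set y | e y = e x].
  move=> ce; apply: (ce x [set e x]); exact: (@discrete_set1 (discrete_topology V)).
have ? : Filter (nbhs (x : {ptws 'I_i.+1 -> G})) by exact: nbhs_filter.
apply: filterS2 (locst _ cc) (locst _ cd) => y /= cy dy.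
rewrite /= cochainBE cy dy -cochainBE; exact: nbhs_singleton Ax.
Qed.

Lemma continuous_equivariant0 i :
  continuous_cochain (0 : cochain G V i) /\ equivariant rho (0 : cochain G V i).
Proof. by split; [exact: continuous_cochain0|exact: equivariant0]. Qed.

Lemma continuous_equivariantB i (c d : cochain G V i) :
  continuous_cochain c /\ equivariant rho c ->
  continuous_cochain d /\ equivariant rho d ->
  continuous_cochain (c - d) /\ equivariant rho (c - d).
Proof.
move=> [cc ce] [dc de].
by split; [exact: continuous_cochainB|exact: equivariantB].
Qed.

Definition continuous_equivariant_cochains : cochain_family G V :=
  CochainFamily continuous_equivariant0 continuous_equivariantB.

End ContinuousCochains.

Definition group_cohomology (F : pzRingType) (G : groupType) (V : lmodType F)
    (rho : representation G V) (i : nat) : zmodType :=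
  cohomology (equivariant_cochains rho) i.

Definition continuous_cohomology (F : pzRingType) (G : preTopologicalGroupType)
    (V : lmodType F) (rho : representation G V) (i : nat) : zmodType :=
  cohomology (continuous_equivariant_cochains rho) i.

Section Restriction.
Variables (F : pzRingType) (G : preTopologicalGroupType) (G' : groupType).
Variables (V : lmodType F) (f : {multiplicative G' -> G}).
Variables (rho : representation G V).

Definition res_cochain (i : nat) (c : cochain G V i) : cochain G' V i :=
  fun g => c (fun k => f (g k)).

Lemma res_coboundary i (c : cochain G V i) :
  coboundary (res_cochain c) = res_cochain (coboundary c).
Proof. by []. Qed.

Lemma res_equivariant i (c : cochain G V i) :
  equivariant rho c -> equivariant (pullback_rep f rho) (res_cochain c).
Proof.
move=> ce h g; rewrite /res_cochain -[RHS]ce; congr c.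
by apply/funext => k; rewrite gmulfM.
Qed.

Local Notation Ccts := (continuous_equivariant_cochains rho).
Local Notation C := (equivariant_cochains (pullback_rep f rho)).

Lemma res_cocycle_subproof i (c : cocycle Ccts i) :
  res_cochain c \in is_cocycle C (i := i).
Proof.
have /asboolP[[_ ce] c0] := valP c; apply/asboolP; split.
  exact: res_equivariant.
by rewrite res_coboundary [coboundary _]c0.
Qed.

Definition res_cocycle i (c : cocycle Ccts i) : cocycle C i :=
  Cocycle (res_cocycle_subproof c).

Lemma res_cocycleB i : {morph @res_cocycle i : c d / c - d}.
Proof. by move=> c d; apply: val_inj. Qed.

Lemma res_is_coboundary i (c : cochain G V i) :
  is_coboundary Ccts c -> is_coboundary C (res_cochain c).
Proof.
case: i c => [|j] c /=; first by move=> ->.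
move=> [e [_ ee] <-]; exists (res_cochain e); first exact: res_equivariant.
exact: res_coboundary.
Qed.

(* the class of a cocycle [c] is sent to that of [res_cocycle c], see
   [restriction_class] *)
Definition restriction (i : nat) (x : continuous_cohomology rho i) :
    group_cohomology (pullback_rep f rho) i :=
  cohomology_class (res_cocycle (repr x)).

Lemma restriction_class i (c : cocycle Ccts i) :
  restriction (cohomology_class c) = cohomology_class (res_cocycle c).
Proof.
apply/cohomology_class_eqP.
apply: (@res_is_coboundary i (val (repr (cohomology_class c)) - val c)).
apply/cohomology_class_eqP; by rewrite /cohomology_class reprK.
Qed.

Lemma restriction_zmod_morphism i : zmod_morphism (@restriction i).
Proof.
move=> x y.
have [c ->] := cohomology_class_repr x; have [d ->] := cohomology_class_repr y.
rewrite -cohomology_classB !restriction_class -cohomology_classB.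
by rewrite res_cocycleB.
Qed.

HB.instance Definition _ i := GRing.isZmodMorphism.Build
  (continuous_cohomology rho i) (group_cohomology (pullback_rep f rho) i)
  (@restriction i) (@restriction_zmod_morphism i).

End Restriction.

Arguments restriction {F G G' V} f rho i x.

(* Main.v *)
(** Discrete and continuous cohomology are compared through the double complex
    of functions of a elements of Gamma and b elements of K which are locally
    constant in the latter and Gamma-equivariant.  Its rows are exact because an
    element of Gamma can be used as an element of K, and a column is exact as
    soon as Gamma has no higher cohomology with values in the locally constant
    functions on K^b, b > 0.  The zigzag this gives is the restriction map, by
    composition with the Alexander-Whitney map.

    For the vanishing, Kolchin's theorem and the boundedness of the denominators
    of Gamma embed Gamma in the group of unitriangular integer matrices, so that
    the matrix entries give a chain of subgroups H' < H with H/H' generated by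
    some t of infinite order.  If the functions have no higher H'-cohomology,
    then they have no higher H-cohomology provided t - 1 is surjective on the
    H'-invariant ones.  The equation (t - 1) f' = f is solved by partial sums of
    the translates of f along the t-orbits on a finite quotient of H'\K; they are
    consistent if f sums to 0 on each orbit.  The p-adic topology of K makes the
    lengths of these orbits divisible by arbitrarily large powers of p, and f is
    killed by p, so a deep enough finite quotient does. *)
Require Import Defs.
From HB Require Import structures.
From mathcomp Require Import all_boot all_order all_algebra all_field.
From mathcomp Require Import all_classical topology.
From mathcomp Require mpoly.
Set Implicit Arguments.
Unset Strict Implicit.
Unset Printing Implicit Defensive.
Import Order.TTheory GRing.Theory Num.Theory.

Local Open Scope classical_set_scope.
Local Open Scope ring_scope.

(** * Cochains on sequences *)

Section Sequences.
Variable T : Type.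

(** At least one argument in K is what makes the vanishing possible: the level of the first argument
    is a coordinate that t translates by 1, and it selects the partial sum to be used. On V alone, t
    - 1 need not be surjective.

    Continuity on the compact group K is uniform, so the topology enters only through one decreasing
    sequence of subgroups U s. They have to be normal in K, both for left translation by U s to fix
    a locally constant function and for the levels to be defined modulo a period. The rational base
    change that makes Gamma integral unitriangular provides this: after it K consists of p-adic
    integral matrices, in which congruence to 1 modulo p^s defines a normal subgroup. The same base
    change provides the integer coordinates of Gamma, so g in U s forces p^s to divide every
    coordinate of g.

    On the subgroup where the earlier coordinates vanish, a coordinate has image c Z, and p may
    divide c. Dividing by c costs a bounded power of p, and so does the period of f; this is why
    arbitrarily large powers of p are asked for. *)

Definition fcons (x : T) (g : nat -> T) : nat -> T :=
  fun k => if k is k'.+1 then g k' else x.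

Definition ftail (g : nat -> T) : nat -> T := fun k => g k.+1.

Lemma fcons_tail (g : nat -> T) : fcons (g 0%N) (ftail g) = g.
Proof. by apply/funext; case. Qed.

Definition depends_on (X : Type) n (c : (nat -> T) -> X) :=
  forall g g', (forall k, (k < n)%N -> g k = g' k) -> c g = c g'.

Lemma depends_on_cons (X : Type) n (c : (nat -> T) -> X) x :
  depends_on n.+1 c -> depends_on n (fun h => c (fcons x h)).
Proof. by move=> cn g g' gg'; apply: cn => -[|k] //= /gg'. Qed.

(* A cochain in n variables is a function of a sequence reading its first n
   entries only; the recursion unfolds the alternating sum of faces. *)
Fixpoint diff (X : zmodType) n (c : (nat -> T) -> X) (g : nat -> T) : X :=
  if n is m.+1 then c (ftail g) - diff m (fun h => c (fcons (g 0%N) h)) (ftail g)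
  else c (ftail g).

Section Diff.
Variable X : zmodType.
Implicit Types (c d : (nat -> T) -> X) (g : nat -> T).

Lemma diff_cons n c x g :
  diff n.+1 c (fcons x g) = c g - diff n (fun h => c (fcons x h)) g.
Proof. by []. Qed.

Lemma diffB n c d g : diff n (fun h => c h - d h) g = diff n c g - diff n d g.
Proof.
elim: n c d g => [//|n IHn] c d g /=.
by rewrite IHn opprD addrACA -opprD.
Qed.

Lemma diff0 n g : diff n (fun=> 0 : X) g = 0.
Proof. by elim: n g => [//|n IHn] g /=; rewrite IHn subrr. Qed.

Lemma diff_diff n c g : diff n.+1 (diff n c) g = 0.
Proof.
elim: n c g => [|n IHn] c g; first exact: subrr.
rewrite [LHS]/= -/(diff n.+1 c (ftail g)).
rewrite -[X in _ - X]/(diff n.+1 (fun h => c h - diff n (fun h' => c (fcons (g 0%N) h')) h) (ftail g)).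
by rewrite diffB IHn subr0 subrr.
Qed.

Lemma depends_on_diff n c : depends_on n c -> depends_on n.+1 (diff n c).
Proof.
elim: n c => [|n IHn] c cn g g' gg' /=; first exact: cn.
rewrite (cn (ftail g) (ftail g')) ?gg' //; last by move=> k kn; apply: gg'.
congr (_ - _); apply: IHn; first exact: depends_on_cons.
by move=> k kn; apply: gg'.
Qed.

(** Freezing the first entry is a contracting homotopy. A constant entry serves the trivial group,
    an element of [G] mapped to [K] serves the rows of the double complex. *)
Lemma contract_diff n c x g : (forall h, diff n.+1 c h = 0) ->
  diff n (fun h => c (fcons x h)) g = c g.
Proof. by move=> /(_ (fcons x g)) /eqP; rewrite diff_cons subr_eq0 => /eqP. Qed.

Lemma diff1_const c g g' : depends_on 1 c -> (forall h, diff 1 c h = 0) -> c g = c g'.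
Proof.
move=> c1 c0.
have ca h : c (ftail h) = c h.
  have /= /eqP := c0 h; rewrite subr_eq0 => /eqP ->.
  by apply: c1 => -[].
(* The sequence that starts with [g 0] and continues as [g'] has tail [g'], so [ca] compares the two
   values. *)
rewrite -[RHS]/(c (ftail (fcons (g 0%N) g'))) ca.
by apply: c1 => -[].
Qed.

End Diff.

Lemma raddf_diff (X Y : zmodType) (f : X -> Y) n c g : {morph f : x y / x - y} ->
  diff n (fun h => f (c h)) g = f (diff n c g).
Proof. by move=> fB; elim: n c g => [//|n IHn] c g /=; rewrite fB IHn. Qed.

End Sequences.

Lemma diff_map (T T' : Type) (X : zmodType) (f : T -> T') n
    (c : (nat -> T') -> X) (g : nat -> T) :
  diff n (fun h => c (f \o h)) g = diff n c (f \o g).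
Proof.
elim: n c g => [//|n IHn] c g /=; congr (_ - _).
rewrite -(IHn (fun h => c (fcons (f (g 0%N)) h))); congr (diff n _ _).
by apply/funext => h; congr c; apply/funext; case.
Qed.

Lemma subr_closed_addr (Y : zmodType) (P : set Y) : P 0 ->
  (forall y z, P y -> P z -> P (y - z)) -> forall y z, P y -> P z -> P (y + z).
Proof.
move=> P0 PB y z Py Pz; rewrite -[z]opprK; apply: (PB _ _ Py).
by rewrite -sub0r; exact: PB.
Qed.

(** Partial sums of the translates of [f], extended to negative indices by the inverse [T']; a
    subgroup stable under both maps contains them all. *)
Lemma affine_iterates (Y : zmodType) (T T' : Y -> Y) (P : set Y) (f : Y) :
  cancel T' T ->
  P 0 -> (forall y z, P y -> P z -> P (y - z)) ->
  (forall y, P y -> P (T y)) -> (forall y, P y -> P (T' y)) -> P f ->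
  exists S : int -> Y,
    [/\ S 0 = 0, forall z, S (z + 1) = T (S z) + f & forall z, P (S z)].
Proof.
move=> TK P0 PB PT PT' Pf; pose A y := T y + f; pose B y := T' (y - f).
have BK : cancel B A by move=> y; rewrite /A /B TK subrK.
exists (fun z => match z with Posz m => iter m A 0 | Negz m => iter m.+1 B 0 end).
split=> //.
- case=> [m|[|m]].
  + by rewrite [_ + 1]addrC -intS.
  + by rewrite NegzE addNr -[LHS](BK 0).
  + by rewrite NegzE intS opprD addrAC addNr add0r -NegzE -[LHS](BK _).
- case=> m; elim: m => [|m IHm] //=; rewrite /A /B.
  + by apply: (subr_closed_addr P0 PB) => //; apply: PT.
  + by apply/PT'/PB.
  + by apply/PT'/PB.
Qed.

(** * Group cohomology along an infinite cyclic quotient *)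

Section Acyclic.
Variables (G : groupType) (X : zmodType) (act : G -> X -> X) (M : set X).
Hypothesis act1 : forall x, act 1%g x = x.
Hypothesis actM : forall g h x, act (g * h)%g x = act g (act h x).
Hypothesis actB : forall g, {morph act g : x y / x - y}.
Hypothesis M0 : M 0.
Hypothesis MB : forall x y, M x -> M y -> M (x - y).
Hypothesis Mact : forall g x, M x -> M (act g x).

Implicit Types (H : set G) (g : nat -> G) (c : (nat -> G) -> X) (t h : G).

Definition gmul h g : nat -> G := fun k => (h * g k)%g.

Lemma gmulA h h' g : gmul h (gmul h' g) = gmul (h * h')%g g.
Proof. by apply/funext => k; rewrite /gmul mulgA. Qed.

Lemma gmul1 g : gmul 1%g g = g.
Proof. by apply/funext => k; rewrite /gmul mul1g. Qed.

Definition equivariant_on H c := forall h, H h -> forall g, c (gmul h g) = act h (c g).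
Definition invariant_on H x := forall h, H h -> act h x = x.
Definition valued c := forall g, M (c g).

(** The arguments range over all of [G], a free [H]-set, so one complex serves every subgroup of the
    chain. *)
Record adapted H n c : Prop := Adapted {
  adapted_dep : depends_on n c;
  adapted_val : valued c;
  adapted_eqv : equivariant_on H c }.

Lemma act0 h : act h 0 = 0.
Proof. by rewrite -{1}(subrr 0) actB subrr. Qed.

Lemma actN h x : act h (- x) = - act h x.
Proof. by rewrite -sub0r actB act0 sub0r. Qed.

Lemma adaptedB H n c d : adapted H n c -> adapted H n d -> adapted H n (fun g => c g - d g).
Proof.
move=> [cn cv ce] [dn dv de]; split.
- by move=> g g' gg'; rewrite (cn g g')// (dn g g').
- by move=> g; exact: MB.
- by move=> h Hh g; rewrite ce// de// actB.
Qed.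

Lemma adapted0 H n : adapted H n (fun=> 0).
Proof. by split=> // h _ g; rewrite act0. Qed.

Lemma valued_diff n c : valued c -> valued (diff n c).
Proof.
by elim: n c => [|n IHn] c cv g /=; [exact: cv|apply: MB => //; exact: IHn].
Qed.

Lemma diff_gmul n h c g :
  diff n c (gmul h g) = diff n (fun g' => c (gmul h g')) g.
Proof. by rewrite -(diff_map (fun x => h * x)%g). Qed.

Lemma equivariant_diff H n c : equivariant_on H c -> equivariant_on H (diff n c).
Proof.
move=> ce h Hh g; rewrite diff_gmul -(raddf_diff _ _ _ (@actB h)).
by congr (diff _ _ _); apply/funext => g'; exact: ce.
Qed.

Lemma adapted_diff H n c : adapted H n c -> adapted H n.+1 (diff n c).
Proof.
move=> [cn cv ce]; split; [exact: depends_on_diff|exact: valued_diff|].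
exact: equivariant_diff.
Qed.

(** [n.+2] variables mean degree [n.+1]: nothing is asked of the invariants. *)
Definition acyclic H := forall n c, adapted H n.+2 c ->
  (forall g, diff n.+2 c g = 0) ->
  exists2 b, adapted H n.+1 b & forall g, diff n.+1 b g = c g.

Lemma acyclic_trivial H : (forall h, H h -> h = 1%g) -> acyclic H.
Proof.
move=> H1 n c [cn cv ce] c0; exists (fun g => c (fcons 1%g g)).
  split; [exact: depends_on_cons|by move=> g; exact: cv|].
  by move=> h /H1 -> g; rewrite act1 gmul1.
by move=> g; exact: contract_diff.
Qed.

(** The action of an element normalizing [H] on [H]-equivariant cochains. With [K] in place of [G]
    it is also the translation action on functions, [actK] below. *)
Definition twist h c : (nat -> G) -> X := fun g => act h (c (gmul h^-1%g g)).

Lemma twist_diff h n c : twist h (diff n c) = diff n (twist h c).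
Proof.
by apply/funext => g; rewrite [LHS]/twist diff_gmul -(raddf_diff _ _ _ (@actB h)).
Qed.

Section Step.
Variables (H H' : set G) (t : G) (l : G -> int).
Hypothesis Ht : H t.
Hypothesis HH' : forall h, H' h -> H h.
Hypothesis tH' : forall h, H' h -> H' (t * h * t^-1)%g.
Hypothesis tVH' : forall h, H' h -> H' (t^-1 * h * t)%g.
Hypothesis Hgen : forall h, H h ->
  exists n h', H' h' /\ (h = (t ^+ n * h')%g \/ (t ^+ n * h = h')%g).
Hypothesis lt1 : forall x, l (t * x)%g = l x + 1.
Hypothesis lH' : forall h x, H' h -> l (h * x)%g = l x.

Lemma adapted_twist s n c :
  (forall h, H' h -> H' (s^-1 * h * s)%g) -> adapted H' n c -> adapted H' n (twist s c).
Proof.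
move=> sH [cn cv ce]; split.
- by move=> g g' gg'; rewrite /twist; congr act; apply: cn => k kn; rewrite /gmul gg'.
- by move=> g; exact: Mact.
move=> h Hh g; rewrite /twist gmulA.
have -> : (s^-1 * h = (s^-1 * h * s) * s^-1)%g by rewrite mulgK.
rewrite -gmulA ce; last exact: sH.
by rewrite -!actM !mulgA mulgV mul1g.
Qed.

Lemma twistK s : cancel (twist s^-1%g) (twist s).
Proof.
move=> c; apply/funext => g; rewrite /twist gmulA invgK mulgV gmul1 -actM.
by rewrite mulgV act1.
Qed.

Lemma adapted_gen n c : adapted H' n c -> (forall g, twist t c g = c g) -> adapted H n c.
Proof.
move=> [cn cv ce] ct; split=> //.
have ct1 g : c (gmul t g) = act t (c g).
  by rewrite -ct /twist gmulA mulVg gmul1.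
have ctn m g : c (gmul (t ^+ m)%g g) = act (t ^+ m)%g (c g).
  elim: m g => [|m IHm] g; first by rewrite expg0 gmul1 act1.
  by rewrite expgS -gmulA ct1 IHm actM.
move=> h /Hgen [m [h' [Hh' [->|e]]]] g; first by rewrite -gmulA ctn ce// actM.
rewrite -[LHS]act1 -(mulVg (t ^+ m)%g) actM -ctn gmulA e ce//.
by rewrite -e actM -actM mulVg act1.
Qed.

(* A cochain in n.+1 variables can be integrated along t because the level l of
   its first argument makes the action of t free. *)
Lemma twist_surj n e : adapted H' n.+1 e ->
  exists2 e', adapted H' n.+1 e' & forall g, twist t e' g - e' g = e g.
Proof.
move=> eg.
have [||||||S [S0 ST SP]] := @affine_iterates ((nat -> G) -> X)
    (twist t) (twist t^-1%g) (adapted H' n.+1) e.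
- exact: twistK.
- exact: adapted0.
- exact: adaptedB.
- by move=> y; apply: adapted_twist.
- by move=> y; apply: adapted_twist => h; rewrite invgK; exact: tH'.
- exact: eg.
exists (fun g => - S (l (g 0%N)) g).
  split.
  - move=> g g' gg'; rewrite (gg' 0%N)//.
    by congr (- _); apply: (adapted_dep (SP _)).
  - by move=> g; rewrite -sub0r; apply: MB => //; exact: adapted_val (SP _) _.
  - by move=> h Hh g; rewrite {1}/gmul lH'// (adapted_eqv (SP _))// actN.
move=> g; set g' := gmul t^-1%g g.
have key : S (l (g 0%N)) g = act t (S (l (g' 0%N)) g') + e g.
  have -> : l (g 0%N) = l (g' 0%N) + 1.
    by rewrite /g' /gmul -lt1 mulgA mulgV mul1g.
  by rewrite ST.
change (act t (- S (l (g' 0%N)) g') - - S (l (g 0%N)) g = e g).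
by rewrite key actN; move: (act t _) (e g) => x y; rewrite opprK addKr.
Qed.

(** Over [H'] the cocycle [c] bounds some [b], which is [H]-equivariant once [t] fixes it. So [b] is
    corrected by a cocycle [d] with the same defect, [(t - 1) d = (t - 1) b]: the Hochschild-Serre
    argument for [H/H'], written out on cochains. *)
Lemma acyclic_step :
  (forall x, M x -> invariant_on H' x ->
     exists x', [/\ M x', invariant_on H' x' & act t x' - x' = x]) ->
  acyclic H' -> acyclic H.
Proof.
move=> surj acH' n c [cn cv ce] c0.
have [//|b bg bc] := acH' n c _ c0; first by split=> // h /HH'; exact: ce.
pose e g := twist t b g - b g.
have eg : adapted H' n.+1 e by apply: adaptedB => //; apply: adapted_twist.
have e0 g : diff n.+1 e g = 0.
  rewrite diffB -twist_diff bc /twist.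
  by rewrite bc -ce// gmulA mulgV gmul1 subrr.
suff [d dg [de d0]] : exists2 d, adapted H' n.+1 d &
    (forall g, twist t d g - d g = e g) /\ (forall g, diff n.+1 d g = 0).
  exists (fun g => b g - d g); last by move=> g; rewrite diffB d0 subr0.
  apply: adapted_gen; first exact: adaptedB.
  move=> g; rewrite /twist actB -!/(twist _ _ _).
  have /eqP := de g; rewrite subr_eq => /eqP; rewrite /twist => ->.
  by rewrite opprD addrA opprB addrCA subrr addr0 /e /twist.
clearbody e; clear c cn cv ce c0 b bg bc.
(* For [n = 0] the defect is a single invariant element of [M], and [surj] is needed. Otherwise it
   bounds some [e1], which [twist_surj] integrates at the level of cochains. *)
case: n e eg e0 => [|n] e eg e0.
  have ecst g : e g = e (fun=> 1%g) by apply: diff1_const => //; exact: adapted_dep eg.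
  have [||x [Mx Hx xe]] := surj (e (fun=> 1%g)).
  - exact: adapted_val eg _.
  - by move=> h Hh; rewrite -(adapted_eqv eg)// ecst.
  exists (fun=> x); last by split=> g /=; rewrite ?subrr// ecst -xe.
  by split=> // h Hh g; rewrite Hx.
have [e1 e1g e1e] := acH' n e eg e0.
have [e2 e2g e2e] := twist_surj e1g.
exists (diff n.+1 e2); first exact: adapted_diff.
split=> g; last exact: diff_diff.
by rewrite twist_diff -diffB -e1e; congr diff; apply/funext.
Qed.

End Step.

End Acyclic.

(** * Vanishing for locally constant functions *)

(** [q] is the least positive element, or 0 for the trivial subgroup, since [0 %| z] means
    [z = 0]. *)
Lemma int_subgroup_principal (I : set int) : I 0 ->
  (forall x y, I x -> I y -> I (x - y)) ->
  exists q : nat, forall z, I z <-> (q %| z)%Z.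
Proof.
move=> I0 IB.
have IN x : I x -> I (- x) by move=> Ix; rewrite -sub0r; exact: IB.
have IX x n : I x -> I (x *+ n).
  move=> Ix; elim: n => [|n IHn]; first by rewrite mulr0n.
  by rewrite mulrS; exact: (subr_closed_addr I0 IB).
have IM x y : I x -> I (y * x).
  move=> Ix; case: y => n; first by rewrite -natz mulr_natl; exact: IX.
  by rewrite NegzE mulNr; apply: IN; rewrite -natz mulr_natl; exact: IX.
have [[n nP]|] := pselect (exists n : nat, `[< (0 < n)%N /\ I n >]); last first.
  move=> NP; exists 0%N => z; rewrite dvd0z; split=> [Iz|/eqP->//].
  apply: contra_notT NP => z0; exists `|z|%N; apply/asboolP.
  split; first by rewrite absz_gt0.
  by case: z Iz {z0} => // m /IN; rewrite NegzE opprK.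
have ex : exists n : nat, `[< (0 < n)%N /\ I n >] by exists n.
case: (ex_minnP ex) => q /asboolP[q0 Iq] qmin; exists q => z.
split=> [Iz|/dvdzP[k ->]]; last exact: IM.
apply/dvdz_mod0P/eqP; apply: contraTT isT => zq /=.
have Im : I (z %% q)%Z by rewrite /modz; apply: IB => //; exact: IM.
have q0' : q%:Z != 0 by rewrite eqz_nat -lt0n.
have zge := modz_ge0 z q0'.
have zlt : (z %% q < q)%Z by rewrite ltz_pmod.
move: Im zq zge zlt; case: (z %% q)%Z => // m Im m0 _ mq.
have /qmin : `[< (0 < m)%N /\ I m >].
  by apply/asboolP; split=> //; rewrite lt0n -eqz_nat.
by rewrite leqNgt -ltz_nat mq.
Qed.

Section Level.
Variables (G Y : groupType) (psi : {multiplicative G -> Y}).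
Variables (H : set G) (mu : G -> int) (W : set Y) (q : nat).
Hypothesis H1 : H 1%g.
Hypothesis HM : forall g h, H g -> H h -> H (g * h)%g.
Hypothesis HV : forall g, H g -> H (g^-1)%g.
Hypothesis muM : forall g h, H g -> H h -> mu (g * h)%g = mu g + mu h.
Hypothesis W1 : W 1%g.
Hypothesis WM : forall u v, W u -> W v -> W (u * v)%g.
Hypothesis WV : forall u, W u -> W (u^-1)%g.
Hypothesis WJ : forall u x, W u -> W (x^-1 * u * x)%g.
Hypothesis Wq : forall h, H h -> W (psi h) -> (q %| mu h)%Z.

(** A base point is chosen in each double coset of [psi H] and [W], and the level of [x] is [mu] of
    an element of [H] moving the base point to [x] modulo [W]. Two such elements differ by one that
    fixes the base point modulo [W]; by normality its image lies in [W], so the level is well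
    defined modulo [q]. *)
Lemma exists_level : exists l : Y -> int, forall h x y, H h ->
  W (y^-1 * (psi h * x))%g -> (q %| l y - l x - mu h)%Z.
Proof.
have psi1 : psi 1%g = 1%g by apply: (mulIg (psi 1%g)); rewrite -gmulfM !mul1g.
have psiV h : psi h^-1%g = (psi h)^-1%g.
  by apply: (mulIg (psi h)); rewrite -gmulfM !mulVg.
have mu1 : mu 1%g = 0.
  by apply: (addIr (mu 1%g)); rewrite -muM// mul1g add0r.
have muV h : H h -> mu h^-1%g = - mu h.
  by move=> Hh; apply: (addIr (mu h)); rewrite -muM ?mulVg ?mu1 ?addNr//; exact: HV.
pose R z x := exists2 h, H h & W (x^-1 * (psi h * z))%g.
(* The choice depends only on the set of candidates, hence is common to all members of a double
   coset; this is [rE]. *)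
pose r x := xget 1%g [set z | R z x].
have Rr x : R (r x) x.
  rewrite /r; case: xgetP => // /(_ x) []; exists 1%g => //.
  by rewrite psi1 mul1g mulVg.
have Rstep h x y z : H h -> W (y^-1 * (psi h * x))%g -> R z x -> R z y.
  move=> Hh Wyx [k Hk Wk]; exists (h * k)%g; first exact: HM.
  have -> : (y^-1 * (psi (h * k)%g * z) = (y^-1 * (psi h * x)) * (x^-1 * (psi k * z)))%g.
    by rewrite gmulfM -!mulgA mulVKg.
  exact: WM.
have rE h x y : H h -> W (y^-1 * (psi h * x))%g -> r x = r y.
  move=> Hh Wyx; rewrite /r; congr xget; apply/seteqP; split=> z /=.
    exact: Rstep Wyx.
  apply: (Rstep h^-1%g); first exact: HV.
  have -> : (x^-1 * (psi h^-1%g * y) = (y^-1 * (psi h * x))^-1)%g.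
    by rewrite psiV !invgM invgK mulgA.
  exact: WV.
pose k x := xget 1%g [set h | H h /\ W (x^-1 * (psi h * r x))%g].
have kP x : H (k x) /\ W (x^-1 * (psi (k x) * r x))%g.
  by rewrite /k; case: xgetP => [h _ //|]; have [h Hh Wh] := Rr x => /(_ h) [].
exists (fun x => mu (k x)) => h x y Hh Wyx.
have [Hx Wx] := kP x; have [Hy Wy] := kP y.
have Hyhx : H ((k y)^-1 * h * k x)%g by do !apply: HM => //; apply: HV.
have := Wq Hyhx; rewrite !muM//; last 2 first.
- exact: HV.
- by apply: HM => //; apply: HV.
rewrite muV// => /(_ _) dv.
have -> : mu (k y) - mu (k x) - mu h = - (- mu (k y) + mu h + mu (k x)).
  by rewrite !opprD opprK addrAC.
rewrite rpredN; apply: dv.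
have W2 : W ((r x)^-1 * psi ((k y)^-1 * h * k x)%g * r x)%g.
  have -> : ((r x)^-1 * psi ((k y)^-1 * h * k x)%g * r x =
     (y^-1 * (psi (k y) * r y))^-1 * ((y^-1 * (psi h * x)) * (x^-1 * (psi (k x) * r x))))%g.
    rewrite -(rE _ _ _ Hh Wyx) !gmulfM psiV !invgM invgK -!mulgA; congr (_ * (_ * _))%g.
    by rewrite !mulVKg.
  by apply: WM; [exact: WV|exact: WM].
have := WJ (r x)^-1%g W2; rewrite invgK.
by rewrite !mulgA mulgV mul1g mulgK.
Qed.

End Level.

Section DenseMap.
Variables (G K : groupType) (phi : {multiplicative G -> K}) (p : nat).
Variables (F : pzRingType) (V : lmodType F) (rho : representation K V).
Variable U : nat -> set K.
Hypothesis p_prime : prime p.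
Hypothesis V_char : forall v : V, v *+ p = 0.
Hypothesis U1 : forall s, U s 1%g.
Hypothesis UM : forall s u v, U s u -> U s v -> U s (u * v)%g.
Hypothesis UV : forall s u, U s u -> U s (u^-1)%g.
Hypothesis UJ : forall s u x, U s u -> U s (x^-1 * u * x)%g.
Hypothesis US : forall s u, U s.+1 u -> U s u.
Hypothesis U_finite : forall s, exists r : seq K,
  forall x, exists2 y, y \in r & U s (y^-1 * x)%g.
Hypothesis phi_dense : forall s x, exists g, U s (x^-1 * phi g)%g.
Hypothesis rho_smooth : forall v, exists s, forall u, U s u -> rho u v = v.

Lemma U_le s s' u : (s <= s')%N -> U s' u -> U s u.
Proof.
by move=> /subnK <-; elim: (s' - s)%N => [//|m IHm] /US; rewrite -/addn.
Qed.

Lemma phi1 : phi 1%g = 1%g.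
Proof. by apply: (mulIg (phi 1%g)); rewrite -gmulfM !mul1g. Qed.

Lemma phiV g : phi g^-1%g = (phi g)^-1%g.
Proof. by apply: (mulIg (phi g)); rewrite -gmulfM !mulVg phi1. Qed.

Local Notation X := ((nat -> K) -> V).

(** Functions of whole sequences, so that all [b] share the type [X]; [b] is the number of entries
    that are read. *)
Definition constant_mod s b : set X := [set f | forall x y,
  (forall k, (k < b)%N -> U s ((x k)^-1 * y k)%g) -> f x = f y].

(** One [s] for all points: on a compact [K] this is continuity into discrete [V]. *)
Definition locally_constant b : set X := [set f | exists s, constant_mod s b f].

Local Notation M := locally_constant.
Local Notation actK := (twist (fun k v => rho k v)).

Definition actG (g : G) (f : X) : X := actK (phi g) f.

Lemma actK1 f : actK 1%g f = f.
Proof. by apply/funext => x; rewrite /twist invg1 gmul1 rep_act1. Qed.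

Lemma actKM g h f : actK (g * h)%g f = actK g (actK h f).
Proof. by apply/funext => x; rewrite /twist gmulA rep_actM invgM. Qed.

Lemma actKB g : {morph actK g : x y / x - y}.
Proof. by move=> x y; apply/funext => z; rewrite /twist linearB. Qed.

Lemma actG1 f : actG 1%g f = f.
Proof. by rewrite /actG phi1 actK1. Qed.

Lemma actGM g h f : actG (g * h)%g f = actG g (actG h f).
Proof. by rewrite /actG gmulfM actKM. Qed.

Lemma actGB g : {morph actG g : x y / x - y}.
Proof. exact: actKB. Qed.

Lemma locally_constant0 b : M b 0.
Proof. by exists 0%N. Qed.

Lemma constant_modB s b f f' :
  constant_mod s b f -> constant_mod s b f' -> constant_mod s b (f - f').
Proof.
by move=> fs fs' x y xy; rewrite -[LHS]/(f x - f' x) (fs x y)// (fs' x y).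
Qed.

Lemma constant_mod_le s s' b f : (s <= s')%N ->
  constant_mod s b f -> constant_mod s' b f.
Proof. by move=> ss' fs x y xy; apply: fs => k /xy; exact: U_le. Qed.

Lemma constant_mod_actK s b k f : constant_mod s b f -> constant_mod s b (actK k f).
Proof.
move=> fs x y xy; rewrite /twist; congr (rho _ _); apply: fs => j jb.
by rewrite /gmul invgM invgK -mulgA mulVKg; exact: xy.
Qed.

Lemma locally_constantB b f f' : M b f -> M b f' -> M b (f - f').
Proof.
move=> [s fs] [s' fs']; exists (maxn s s'); apply: constant_modB.
  by apply: constant_mod_le fs; exact: leq_maxl.
by apply: constant_mod_le fs'; exact: leq_maxr.
Qed.

Lemma locally_constant_actK b k f : M b f -> M b (actK k f).
Proof. by move=> [s fs]; exists s; exact: constant_mod_actK. Qed.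

Lemma locally_constant_actG b g f : M b f -> M b (actG g f).
Proof. exact: locally_constant_actK. Qed.

(** Each entry matters only through finitely many cosets, so only finitely many vectors have to be
    stabilized. *)
Lemma locally_constant_smooth_values b f : M b f ->
  exists s, forall u x, U s u -> rho u (f x) = f x.
Proof.
elim: b f => [|b IHb] f [s fs].
  have [s' s'P] := rho_smooth (f (fun=> 1%g)); exists s' => u x Uu.
  by rewrite (fs x (fun=> 1%g))// s'P.
have [r rP] := U_finite s.
have [t tP] : exists t, forall y, y \in r -> forall u x, U t u ->
    rho u (f (fcons y x)) = f (fcons y x).
  elim: r {rP} => [|y r [t tP]]; first by exists 0%N.
  have [|t' t'P] := IHb (fun x => f (fcons y x)).
    by exists s => x x' xx'; apply: fs => -[|k] kb /=; [rewrite mulVg|exact: xx'].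
  exists (maxn t t') => z; rewrite inE => /orP[/eqP -> u x Uu|zr u x Uu].
    by apply: t'P; apply: U_le Uu; exact: leq_maxr.
  by apply: tP => //; apply: U_le Uu; exact: leq_maxl.
exists t => u x Uu; have [y yr Uy] := rP (x 0%N).
rewrite -(fs (fcons y (ftail x))) ?tP// => -[|k] kb //=.
by rewrite mulVg.
Qed.

(** By normality [u^-1 * x] stays in the coset of [x], so translation by a deep [u] does not affect
    [f], whose values are fixed as well. *)
Lemma smooth_locally_constant b f : M b f ->
  exists s, forall u, U s u -> actK u f = f.
Proof.
move=> Mf; have [s sP] := locally_constant_smooth_values Mf; have [s' s'P] := Mf.
exists (maxn s s') => u Uu; apply/funext => x; rewrite /twist sP; last first.
  by apply: U_le Uu; exact: leq_maxl.
apply: s'P => k _; rewrite /gmul invgM invgK.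
by apply: UJ; apply: U_le Uu; exact: leq_maxr.
Qed.

Section Step.
Variables (H H' : set G) (t : G) (mu : G -> int).
Hypothesis H1 : H 1%g.
Hypothesis HM : forall g h, H g -> H h -> H (g * h)%g.
Hypothesis HV : forall g, H g -> H (g^-1)%g.
Hypothesis H'E : forall g, H' g <-> H g /\ mu g = 0.
Hypothesis muM : forall g h, H g -> H h -> mu (g * h)%g = mu g + mu h.
Hypothesis Ht : H t.
Hypothesis mut : mu t = 1.
Hypothesis mu_adic : forall r, exists s, forall h, H h -> U s (phi h) ->
  ((p ^ r)%N %| mu h)%Z.

Lemma mem_expg n : H (t ^+ n)%g.
Proof. by elim: n => [|n IHn]; [rewrite expg0|rewrite expgS; exact: HM]. Qed.

Lemma mu1 : mu 1%g = 0.
Proof. by apply: (addIr (mu 1%g)); rewrite -muM// mul1g add0r. Qed.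

Lemma muV h : H h -> mu h^-1%g = - mu h.
Proof.
by move=> Hh; apply: (addIr (mu h)); rewrite -muM ?mulVg ?mu1 ?addNr//; exact: HV.
Qed.

Lemma muX n : mu (t ^+ n)%g = n%:Z.
Proof.
elim: n => [|n IHn]; first by rewrite expg0 mu1.
by rewrite expgS muM// ?mut ?IHn -?intS//; exact: mem_expg.
Qed.

(** [q] is the common length of the [t]-orbits on the cosets of [U s] modulo [H']. It is positive
    because among more powers of [t] than there are cosets, two share a coset. *)
Lemma exists_modulus s : exists q : nat, (0 < q)%N /\
  forall z, (exists h, [/\ H h, U s (phi h) & mu h = z]) <-> (q %| z)%Z.
Proof.
have [||q qP] := @int_subgroup_principal
    [set z | exists h, [/\ H h, U s (phi h) & mu h = z]].
- by exists 1%g; rewrite phi1 mu1.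
- move=> x y [g [Hg Ug <-]] [h [Hh Uh <-]]; exists (g * h^-1)%g; split.
  + by apply: HM => //; exact: HV.
  + by rewrite gmulfM phiV; apply: UM => //; exact: UV.
  + by rewrite muM ?muV//; exact: HV.
exists q; split=> //; rewrite lt0n; apply/eqP => q0.
have [r rP] := U_finite s.
pose f (i : 'I_(size r).+1) : 'I_(size r) :=
  let: exist2 y yr _ := cid2 (rP (phi (t ^+ i)%g)) in
  Ordinal (etrans (index_mem y r) yr).
have fP i : U s ((nth 1%g r (f i))^-1 * phi (t ^+ i))%g.
  by rewrite /f; case: cid2 => y yr Uy /=; rewrite nth_index.
have /injectivePn[i [j ij fij]] : ~~ injectiveb f.
  by apply/injectiveP => /leq_card; rewrite !card_ord ltnn.
have Hij : H ((t ^+ i)^-1 * t ^+ j)%g by apply: HM; [apply: HV|]; exact: mem_expg.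
have /qP : exists h, [/\ H h, U s (phi h) & mu h = j%:Z - i%:Z].
  exists ((t ^+ i)^-1 * t ^+ j)%g; split=> //.
    have := UM (UV (fP i)) (fP j).
    rewrite fij invgM invgK -mulgA mulVKg.
    by rewrite gmulfM phiV.
  by rewrite muM// ?muV ?muX 1?addrC//; [exact: mem_expg|apply: HV; exact: mem_expg|exact: mem_expg].
rewrite q0 dvd0z subr_eq0 eqz_nat => /eqP ji.
by case/eqP: ij; apply: val_inj; rewrite /= ji.
Qed.

(* The sum of the translates of f over a period divisible by p * (the period of
   f) vanishes, so the partial sums are well defined modulo a deeper U s. *)
Lemma locally_constant_surj b f : M b.+1 f -> invariant_on actG H' f ->
  exists f', [/\ M b.+1 f', invariant_on actG H' f' & actG t f' - f' = f].
Proof.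
move=> Mf Hf; have [s1 s1P] := smooth_locally_constant Mf.
have [s0 fs0] := Mf.
have [m [m0 mP]] := exists_modulus s1.
(* One factor [p] more than in the period [m] of [f], so that the period [q] below is [m] times a
   multiple of [p]. *)
have [s2 s2P] := mu_adic (logn p m).+1.
pose s := maxn s1 s2.
have [q [q0 qP]] := exists_modulus s.
have /qP[hq [Hhq Uhq muq]] : (q%:Z %| q%:Z)%Z by exact: dvdzz.
have mq : (m %| q)%N.
  suff : (m %| q%:Z)%Z by [].
  by apply/mP; exists hq; split=> //; apply: U_le Uhq; exact: leq_maxl.
have pq : (p ^ (logn p m).+1 %| q)%N.
  suff : ((p ^ (logn p m).+1)%N %| q%:Z)%Z by [].
  by rewrite -muq; apply: s2P => //; apply: U_le Uhq; exact: leq_maxr.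
have [k qE] := dvdnP mq.
have k0 : (0 < k)%N by move: q0; rewrite qE muln_gt0 => /andP[].
have pk : (p %| k)%N.
  move: pq; rewrite pfactor_dvdn// qE lognM//.
  by rewrite -[X in (X < _)%N]add0n ltn_add2r -[p]expn1 pfactor_dvdn ?expn1.
pose T := actG t.
(* The bounds [s0] and [s1] are common to all partial sums: the first makes [f'] locally constant,
   the second gives period [m]. *)
pose P : set X := [set y | [/\ constant_mod s0 b.+1 y, invariant_on actG H' y &
  forall u, U s1 u -> actK u y = y]].
have P0 : P 0.
  split; first by [].
    by move=> h _; rewrite -{1}(subrr 0) actGB subrr.
  by move=> u _; rewrite -{1}(subrr 0) actKB subrr.
have PB y z : P y -> P z -> P (y - z).
  move=> [My Hy Uy] [Mz Hz Uz]; split; first exact: constant_modB.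
    by move=> h Hh; rewrite actGB Hy// Hz.
  by move=> u Uu; rewrite actKB Uy// Uz.
have tH h : H' h -> H' (t^-1 * h * t)%g.
  move=> /H'E[Hh h0]; apply/H'E; have HtV := HV Ht.
  have HtVh := HM HtV Hh.
  by split; [exact: HM|rewrite !muM// h0 muV// addr0 addNr].
have PT y : P y -> P (T y).
  move=> [My Hy Uy]; split; first exact: constant_mod_actK.
    move=> h Hh; rewrite /T -actGM -[in RHS](Hy _ (tH _ Hh)) -actGM.
    by rewrite !mulgA mulgV mul1g.
  move=> u Uu; rewrite /T /actG -actKM.
  rewrite -[in RHS](Uy ((phi t)^-1 * u * phi t)%g (UJ _ Uu)).
  by rewrite -actKM !mulgA mulgV mul1g.
have Pf : P f by [].
have PD := subr_closed_addr P0 PB.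
have TmE y n : iter n T y = actG (t ^+ n)%g y.
  by elim: n => [|n IHn]; rewrite ?expg0 ?actG1//= IHn /T -actGM expgS.
(* Some [h] in [H] acts trivially on [P] and has [mu h = m]; then [h^-1 * t^m] lies in [H']. *)
have Tm y : P y -> iter m T y = y.
  move=> [My Hy Uy]; rewrite TmE.
  have /mP[h [Hh Uh muh]] : (m%:Z %| m%:Z)%Z by exact: dvdzz.
  rewrite -[(t ^+ m)%g](mulVKg h) actGM Hy; first exact: Uy.
  have Hm := mem_expg m; have HhV := HV Hh.
  by apply/H'E; split; [exact: HM|rewrite muM// muV// muX muh addNr].
pose A y := T y + f.
have PA y : P y -> P (A y) by move=> /PT Py; exact: PD.
have PS n : P (iter n A 0) by elim: n => [//|n IHn] /=; exact: PA.
have TD y z : T (y + z) = T y + T z.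
  by rewrite -[in LHS](opprK z) /T actGB (actN actGB) opprK.
have iterA n y : iter n A y = iter n T y + iter n A 0.
  elim: n => [|n IHn] /=; first by rewrite addr0.
  by rewrite IHn /A TD addrA.
have Smk j : iter (j * m) A 0 = iter m A 0 *+ j.
  elim: j => [|j IHj]; first by rewrite mul0n mulr0n.
  by rewrite mulSn iterD iterA Tm// IHj mulrSr.
have Sq : iter q A 0 = 0.
  have [k' kE] := dvdnP pk; rewrite qE kE Smk mulrnA.
  by apply/funext => x; rewrite -[LHS]/((iter m A 0 *+ k' *+ p : X) x) natmulfctE V_char.
have Sqn n j : iter (n + j * q) A 0 = iter n A 0.
  by elim: j => [|j IHj]; rewrite ?addn0// mulSn addnCA iterD// -iterD addnC iterD Sq.
pose S z := iter `|(z %% q)%Z| A 0.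
have q0' : q%:Z != 0 by rewrite eqz_nat -lt0n.
have Snat n : S n%:Z = iter n A 0.
  by rewrite /S modz_nat /= [in RHS](divn_eq n q) addnC Sqn.
have Smod z z' : (q %| z - z')%Z -> S z = S z'.
  by rewrite -eqz_mod_dvd => /eqP zz'; rewrite /S zz'.
have SS z : S (z + 1) = T (S z) + f.
  rewrite -[RHS]/(iter `|(z %% q)%Z|.+1 A 0) -Snat; apply: Smod.
  rewrite -eqz_mod_dvd -modzDml; apply/eqP; congr (_ %% _)%Z.
  by rewrite intS addrC gez0_abs// modz_ge0.
have PSz z : P (S z) by exact: PS.
have [|l lP] := @exists_level G K phi H mu (U s) q H1 HM HV muM (U1 s) (@UM s) (@UV s)
    (fun u x => @UJ s u x).
  by move=> h Hh Uh; apply/qP; exists h.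
(* The level drops by 1 from [x] to its translate by the inverse of [phi t], so [actG t f' - f'] is
   [- T (S z) + S (z + 1)], that is [f]. *)
pose f' : X := fun x => - S (l (x 0%N)) x.
have actS h : H h -> forall x z, (q %| l (x 0%N) - z - mu h)%Z ->
    z = l ((phi h)^-1 * x 0%N)%g ->
    actG h f' x = - actG h (S z) x.
  by move=> Hh x z _ ->; rewrite /actG /twist /f' linearN.
have llP h x : H h -> (q %| l x - l ((phi h)^-1 * x)%g - mu h)%Z.
  by move=> Hh; apply: lP => //; rewrite mulVKg mulVg.
exists f'; split.
- exists (maxn s s0) => x y xy; rewrite /f'.
  have -> : S (l (x 0%N)) = S (l (y 0%N)).
    apply: Smod; have := lP 1%g (y 0%N) (x 0%N) H1.
    rewrite phi1 mul1g mu1 subr0; apply.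
    by apply: U_le (xy 0%N _) => //; exact: leq_maxl.
  congr (- _); have [fs _ _] := PSz (l (y 0%N)).
  by apply: fs => j /xy; apply: U_le; exact: leq_maxr.
- move=> h /[dup] Hh /H'E[Hh' muh]; apply/funext => x.
  rewrite (actS _ Hh' x _ (llP _ _ Hh') erefl).
  have [_ -> // _] := PSz (l ((phi h)^-1 * x 0%N)%g).
  congr (- _ x); apply/esym/Smod.
  by have := llP _ (x 0%N) Hh'; rewrite muh subr0.
- apply/funext => x; rewrite -[LHS]/(actG t f' x - f' x).
  rewrite (actS _ Ht x _ (llP _ _ Ht) erefl).
  set z := l ((phi t)^-1 * x 0%N)%g.
  have Slx : S (l (x 0%N)) x = T (S z) x + f x.
    have -> : S (l (x 0%N)) = S (z + 1).
      by apply: Smod; rewrite opprD addrA -mut; exact: llP.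
    by rewrite SS.
  by rewrite /f' opprK Slx addKr.
Qed.

End Step.

(** * Descent along the chain of coordinate subgroups *)

Section Chain.
Variables (lam : nat -> G -> int) (d : nat).
Definition chain k : set G := [set g | forall j, (j < k)%N -> lam j g = 0].
Hypothesis lamM : forall k g h, chain k g -> chain k h ->
  lam k (g * h)%g = lam k g + lam k h.
Hypothesis lam_adic : forall k s g, U s (phi g) -> ((p ^ s)%N %| lam k g)%Z.
Hypothesis lam_faithful : forall g, chain d g -> g = 1%g.

Lemma chainS k g : chain k.+1 g <-> chain k g /\ lam k g = 0.
Proof.
split=> [gk|[gk g0] j]; first by split=> [j jk|]; apply: gk => //; exact: ltnW.
by rewrite ltnS leq_eqVlt => /orP[/eqP->//|]; exact: gk.
Qed.

Lemma chain1 k : chain k 1%g.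
Proof.
elim: k => [//|k IHk]; apply/chainS; split=> //.
by apply: (addIr (lam k 1%g)); rewrite -lamM// mul1g add0r.
Qed.

Lemma chainM k g h : chain k g -> chain k h -> chain k (g * h)%g.
Proof.
elim: k => [//|k IHk] /chainS[gk g0] /chainS[hk h0]; apply/chainS.
by split; [exact: IHk|rewrite lamM// g0 h0 addr0].
Qed.

Lemma chainV k g : chain k g -> chain k g^-1%g.
Proof.
elim: k => [//|k IHk] /chainS[gk g0]; apply/chainS; split; first exact: IHk.
apply: (addIr (lam k g)); rewrite -lamM//; last exact: IHk.
by rewrite mulVg add0r g0; have /chainS[] := @chain1 k.+1.
Qed.

(** [lam k] embeds the quotient of [chain k] by [chain k.+1] in the integers, with image [c Z].
    Either [c = 0] and the two subgroups agree, or [lam k] divided by [c] is the height [mu] for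
    which some [t] has height 1. *)
Lemma acyclic_chainS b k :
  acyclic actG (M b.+1) (chain k.+1) -> acyclic actG (M b.+1) (chain k).
Proof.
have [||c cP] := @int_subgroup_principal [set z | exists2 g, chain k g & lam k g = z].
- by exists 1%g; [exact: chain1|have /chainS[] := @chain1 k.+1].
- move=> x y [g gk <-] [h hk <-]; exists (g * h^-1)%g.
    by apply: chainM => //; exact: chainV.
  have hVk := chainV hk.
  rewrite lamM//; congr (_ + _); apply: (addIr (lam k h)).
  by rewrite -lamM// mulVg addNr; have /chainS[] := @chain1 k.+1.
have [c0|c_gt0] := posnP c.
  rewrite c0 in cP; suff -> : chain k.+1 = chain k by [].
  apply/seteqP; split=> g; first by case/chainS.
  move=> gk; apply/chainS; split=> //; apply/eqP; rewrite -dvd0z; apply/cP.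
  by exists g.
have [t tk tc] : exists2 g, chain k g & lam k g = c by apply/cP; exact: dvdzz.
have c_neq0 : c%:Z != 0 by rewrite eqz_nat -lt0n.
pose mu g := (lam k g %/ c)%Z.
have lamE g : chain k g -> lam k g = mu g * c.
  by move=> gk; apply/esym/divzK/cP; exists g.
have muM g h : chain k g -> chain k h -> mu (g * h)%g = mu g + mu h.
  move=> gk hk; apply: (mulIf c_neq0); rewrite mulrDl -!lamE//.
    exact: lamM.
  exact: chainM.
have mut : mu t = 1 by apply: (mulIf c_neq0); rewrite -lamE// mul1r.
have H'E g : chain k.+1 g <-> chain k g /\ mu g = 0.
  split=> [/chainS[gk g0]|[gk g0]]; first by rewrite /mu g0 div0z.
  by apply/chainS; rewrite lamE// g0 mul0r.
have mu_adic r : exists s, forall h, chain k h -> U s (phi h) -> ((p ^ r)%N %| mu h)%Z.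
  (* The division by [c] loses [logn p c] factors [p]. *)
  exists (r + logn p c)%N => h hk /(lam_adic k); rewrite lamE//.
  rewrite !dvdzE abszM /=; have [->|mu_gt0] := posnP `|mu h|%N; first by rewrite dvdn0.
  by rewrite !pfactor_dvdn ?muln_gt0 ?mu_gt0// lognM// leq_add2r.
have mu1' := mu1 (@chain1 k) muM.
have muV' h := @muV _ _ (@chain1 k) (@chainV k) muM h.
have muX' := muX (@chain1 k) (@chainM k) muM tk mut.
have tXk n : chain k (t ^+ n)%g := mem_expg (@chain1 k) (@chainM k) tk n.
(* With [W] trivial and [q = 0] the congruence becomes an equality: an exact level on [G], as
   [acyclic_step] wants. *)
have [|||||l lP] := @exists_level G G idfun (chain k) mu [set 1%g] 0 (@chain1 k)
   (@chainM k) (@chainV k) muM.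
- by [].
- by move=> u v -> ->; rewrite /= mul1g.
- by move=> u ->; rewrite /= invg1.
- by move=> u x ->; rewrite /= mulg1 mulVg.
- by move=> h hk /= h1; rewrite h1 mu1'.

have lE h x : chain k h -> l (h * x)%g = l x + mu h.
  move=> hk; apply/eqP; rewrite -subr_eq0 opprD addrA -dvd0z; apply: lP => //=.
  by rewrite mulVg.
apply: (@acyclic_step G X actG (M b.+1) actG1 actGM actGB (locally_constant0 _)
  (@locally_constantB _) (@locally_constant_actG _) (chain k) (chain k.+1) t l) => //.
- by move=> h /chainS[].
- move=> h /H'E[hk h0]; have tVk := chainV tk; have thk := chainM tk hk.
  by apply/H'E; split; [exact: chainM|rewrite !muM// h0 muV'// addr0 subrr].
- move=> h /H'E[hk h0]; have tVk := chainV tk; have thk := chainM tVk hk.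
  by apply/H'E; split; [exact: chainM|rewrite !muM// h0 muV'// addr0 addNr].
- move=> h hk; case nE: (mu h) => [n|n].
    exists n, ((t ^+ n)^-1 * h)%g; split; last by left; rewrite mulVKg.
    have tVk := chainV (tXk n).
    by apply/H'E; split; [exact: chainM|rewrite muM// muV'// muX' nE addNr].
  exists n.+1, (t ^+ n.+1 * h)%g; split; last by right.
  by apply/H'E; split; [exact: chainM|rewrite muM// muX' nE NegzE subrr].
- by move=> g; rewrite lE// mut.
- by move=> h x /H'E[hk h0]; rewrite lE// h0 addr0.
- move=> f Mf Hf.
  exact: (locally_constant_surj (@chain1 k) (@chainM k) (@chainV k) H'E muM tk mut mu_adic).
Qed.

Lemma acyclic_all b : acyclic actG (M b.+1) setT.
Proof.
have -> : setT = chain 0 by apply/seteqP; split.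
have : acyclic actG (M b.+1) (chain d).
  by apply: acyclic_trivial => //; exact: actG1.
by elim: d => [//|k IHk] /acyclic_chainS.
Qed.

End Chain.

(** * The double complex *)

Section Zigzag.
Hypothesis acyc : forall b, acyclic actG (M b.+1) setT.

(** [a] and [b] count variables, so 0 gives the augmentations: invariant functions on [K^b] for
    [a = 0], cochains with values in [V] for [b = 0]. *)
Definition bicochain a b (x : (nat -> G) -> X) := adapted actG (M b) setT a x.

Local Notation actV := (fun g v => rho (phi g) v).
Definition gcochain a (z : (nat -> G) -> V) := adapted actV setT setT a z.

(* On bihomogeneous cochains this is the Alexander-Whitney map: the last of the
   a.+1 elements of G is reused as the first element of K. *)
Definition diagonal a (x : (nat -> G) -> X) : (nat -> G) -> V :=
  fun g => x g (fun k => phi (g (a + k)%N)).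

Lemma actVB g : {morph rho (phi g) : x y / x - y}.
Proof. by move=> x y; rewrite linearB. Qed.

Lemma gcochainB a z z' : gcochain a z -> gcochain a z' ->
  gcochain a (fun g => z g - z' g).
Proof. exact: (@adaptedB _ _ actV setT actVB (fun _ _ _ _ => I)). Qed.

Lemma gcochainZ a z (e : F) : gcochain a z -> gcochain a (fun g => e *: z g).
Proof.
move=> [zn zv ze]; split=> //; first by move=> g g' gg'; rewrite (zn g g').
by move=> h Hh g; rewrite ze// linearZ.
Qed.

Lemma bicochainB a b x y : bicochain a b x -> bicochain a b y ->
  bicochain a b (fun g => x g - y g).
Proof. exact: (@adaptedB _ _ actG (M b) actGB (@locally_constantB b)). Qed.

Lemma constant_mod_diff s n (f f' : X) :
  (forall x y, (forall k, (k < n)%N -> U s ((x k)^-1 * y k)%g) -> f x = f' y) ->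
  forall x y, (forall k, (k < n.+1)%N -> U s ((x k)^-1 * y k)%g) ->
  diff n f x = diff n f' y.
Proof.
elim: n f f' => [|n IHn] f f' ff' x y xy /=; first exact: ff'.
congr (_ - _); first by apply: ff' => k kn; exact: xy.
apply: IHn => [x' y' xy'|k kn]; last exact: xy.
by apply: ff' => -[|k] kn; [exact: xy|exact: xy'].
Qed.

Lemma locally_constant_diff b f : M b f -> M b.+1 (diff b f).
Proof. by move=> [s fs]; exists s => x y; exact: constant_mod_diff. Qed.

Lemma locally_constant_depends b f : M b f -> depends_on b f.
Proof. by move=> [s fs] x y xy; apply: fs => k /xy ->; rewrite mulVg. Qed.

Lemma bicochain_diff1 a b x : bicochain a b x -> bicochain a.+1 b (diff a x).
Proof. exact: (@adapted_diff _ _ actG (M b) actGB (@locally_constantB b)). Qed.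

Lemma actG_diff g b f : actG g (diff b f) = diff b (actG g f).
Proof. exact: (@twist_diff _ _ (fun k v => rho k v) (fun k => linearB (rho k))). Qed.

Lemma bicochain_diff2 a b x :
  bicochain a b x -> bicochain a b.+1 (fun g => diff b (x g)).
Proof.
move=> [xn xv xe]; split.
- by move=> g g' gg'; rewrite (xn g g').
- by move=> g; exact: locally_constant_diff.
- by move=> h Hh g; rewrite xe// actG_diff.
Qed.

Lemma diff2_fun b : {morph (@diff K V b) : f f' / f - f'}.
Proof. by move=> f f'; apply/funext => y; exact: diffB. Qed.

Lemma diff12C a b (x : (nat -> G) -> X) g :
  diff a (fun g => diff b (x g)) g = diff b (diff a x g).
Proof. by rewrite (raddf_diff _ _ _ (@diff2_fun b)). Qed.

Lemma diff1_eval a (x : (nat -> G) -> X) g y : diff a x g y = diff a (fun g => x g y) g.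
Proof. by rewrite -(raddf_diff (f := fun f : X => f y)). Qed.

(** A Leibniz rule. The last face in [G] and the first face in [K] both evaluate [x] at
    [g 0, ..., g a] and the images of [g (a+1), ...], with opposite signs; the remaining faces are
    those of the diagonal. *)
Lemma diff_diagonal a b x g : depends_on a.+1 x ->
  diff (a + b).+1 (diagonal a x) g = diagonal a.+1 (diff a.+1 x) g +
    (-1) ^+ a *: diagonal a (fun g => diff b.+1 (x g)) g.
Proof.
elim: a x g => [|a IHa] x g xa.
  rewrite expr0 scale1r.
  change (x (ftail g) (phi \o ftail g) -
      diff b (fun h => x (fcons (g 0%N) h) (phi \o fcons (g 0%N) h)) (ftail g) =
    x (ftail g) (phi \o ftail g) -
      x (fcons (g 0%N) (ftail (ftail g))) (phi \o ftail g) +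
    (x g (phi \o ftail g) -
      diff b (fun y => x g (fcons (phi (g 0%N)) y)) (phi \o ftail g))).
  have xcons h : x (fcons (g 0%N) h) = x g by apply: xa => -[].
  rewrite xcons addrA subrK -diff_map; congr (_ - diff _ _ _).
  apply/funext => h; rewrite xcons; congr (x g); by apply/funext; case.
pose x0 h := x (fcons (g 0%N) h).
have x0a : depends_on a.+1 x0 by exact: depends_on_cons.
rewrite addSn [LHS]/= -/(diff _ (diagonal a x0) (ftail g)).
rewrite -[X in _ - X]/(diff (a + b).+1 (diagonal a x0) (ftail g)) IHa//.
rewrite -[X in _ = X + _]/((x (ftail g) - diff a.+1 x0 (ftail g)) (fun k => phi (ftail g (a.+1 + k)%N))).
rewrite opprD addrA exprS mulN1r scaleNr; congr (_ - _ *: _).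
by rewrite /diagonal /x0 fcons_tail.
Qed.

Lemma gcochain_diagonal a b x : bicochain a.+1 b.+1 x -> gcochain (a + b).+1 (diagonal a x).
Proof.
move=> [xn xv xe]; split=> //.
  move=> g g' gg'; rewrite /diagonal (xn g g'); last first.
    by move=> k ka; apply: gg'; apply: leq_trans ka _; rewrite ltnS leq_addr.
  by apply: (locally_constant_depends (xv g')) => k kb; rewrite gg'// ltnS leq_add2l.
move=> h Hh g; rewrite /diagonal xe// /actG /twist; congr (rho _ (x g _)).
by apply/funext => k; rewrite /gmul gmulfM mulKg.
Qed.

(** One variable is outside the reach of [acyclic]: there a cocycle is constant, hence an invariant
    function. *)
Lemma column_exact a b x : bicochain a.+1 b.+1 x -> (forall g, diff a.+1 x g = 0) ->
  exists2 y, bicochain a b.+1 y & forall g, diff a y g = x g.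
Proof.
case: a => [|a] xg x0; last exact: acyc.
have xcst g : x (fun=> 1%g) = x g by apply: diff1_const => //; exact: adapted_dep xg.
exists (fun=> x (fun=> 1%g)); last by move=> g; exact: xcst.
split=> //; first by move=> g; exact: adapted_val xg _.
by move=> h Hh g; rewrite -(adapted_eqv xg)//; exact: xcst.
Qed.

(** Contraction with [phi (g 0)], which moves along with [g] and so keeps equivariance, as a
    constant would not. *)
Lemma row_exact a b x : bicochain a.+1 b.+1 x ->
  (forall g y, diff b.+1 (x g) y = 0) ->
  exists2 z, bicochain a.+1 b z & forall g, diff b (z g) = x g.
Proof.
move=> [xn xv xe] x0; exists (fun g y => x g (fcons (phi (g 0%N)) y)); last first.
  by move=> g; apply/funext => y; exact: contract_diff.
split.
- by move=> g g' gg'; apply/funext => y; rewrite (gg' 0%N)// (xn g g').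
- move=> g; have [s xs] := xv g; exists s => y y' yy'; apply: xs => -[|k] kb /=.
    by rewrite mulVg.
  exact: yy'.
- move=> h Hh g; apply/funext => y; rewrite xe// /actG /twist; congr (rho _ (x g _)).
  by apply/funext => -[|k] //=; rewrite /gmul gmulfM mulKg.
Qed.

(** Some [U s] fixes [f], and the image of [phi] meets all its cosets. *)
Lemma dense_invariant b f : M b f -> (forall g, actG g f = f) -> forall k, actK k f = f.
Proof.
move=> Mf fG k; have [s sP] := smooth_locally_constant Mf.
have [g kg] := phi_dense s k.
have -> : k = (phi g * (k^-1 * phi g)^-1)%g by rewrite invgM invgK mulVKg.
by rewrite actKM sP; [exact: fG|exact: UV].
Qed.

Lemma diff_scale n (s : F) (z : (nat -> G) -> V) g :
  diff n (fun h => s *: z h) g = s *: diff n z g.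
Proof. by apply: (raddf_diff (f := fun v : V => s *: v)) => u v; exact: scalerBr. Qed.

(** Write [x] as the [G]-coboundary of [y]. By [diff_diagonal] the diagonals of [x] and of the
    [K]-coboundary of [y] agree up to sign and a coboundary, and the latter has one variable less in
    [G]; at [a = 0] an invariant function on [K] remains. The last clause is for degree 0, where
    only 0 counts as a coboundary. *)
Lemma zigzag_surj a b x : bicochain a.+1 b.+1 x ->
  (forall g, diff a.+1 x g = 0) -> (forall g y, diff b.+1 (x g) y = 0) ->
  exists w z, [/\ M (a + b).+1 w, forall g, actG g w = w,
    forall y, diff (a + b).+1 w y = 0, gcochain (a + b) z &
    (forall g, diagonal a x g = w (phi \o g) + diff (a + b) z g) /\ (a = 0%N -> z = (fun=> 0))].
Proof.
elim: a b x => [|a IHa] b x xg x1 x2; have [y yg yx] := column_exact xg x1.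
  exists (y (fun=> 1%g)), (fun=> 0); rewrite add0n.
  have ycst g : y (fun=> 1%g) = y g by apply: (adapted_dep yg).
  split.
  - exact: adapted_val yg _.
  - by move=> g; rewrite -(adapted_eqv yg)//; apply: (adapted_dep yg).
  - by move=> z; rewrite (ycst (ftail (fun=> 1%g))) -[y _]/(diff 0 y _) yx.
  - exact: (@adapted0 _ _ actV setT actVB I).
  - by split=> // g; rewrite diff0 addr0 /diagonal -yx /= (ycst (ftail g)).
have dyg : bicochain a.+1 b.+2 (fun g => diff b.+1 (y g)) by exact: bicochain_diff2.
have [||w [z [Mw wG w0 zg [xz _]]]] := IHa b.+1 _ dyg.
- by move=> g; rewrite diff12C yx; apply/funext => k; exact: x2.
- by move=> g k; exact: diff_diff.
have yd := adapted_dep yg; pose s : F := (-1) ^+ a.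
rewrite addSnnS.
(* The signs come from solving [diff_diagonal] for [diagonal a.+1 x]. *)
exists (fun k => - (s *: w k)), (fun g => diagonal a y g - s *: z g); split.
- by have [t wt] := Mw; exists t => k k' kk'; rewrite (wt k k').
- by move=> g; apply/funext => k; rewrite -[in RHS](wG g) /actG /twist linearN linearZ.
- move=> k; have sN : {morph (fun v : V => - (s *: v)) : u v / u - v}.
    by move=> u v; rewrite scalerBr opprD.
  by rewrite (raddf_diff _ _ _ sN) w0 scaler0 oppr0.
- apply: gcochainB; first by rewrite addnS; exact: gcochain_diagonal.
  exact: gcochainZ.
split=> // g; rewrite diffB diff_scale.
have -> : x = diff a.+1 y by apply/funext => h; rewrite yx.
have := diff_diagonal b g yd; rewrite -addnS => ->; rewrite -/s.
rewrite -[diagonal a (fun _ => _) g]/(diagonal a (fun g => diff b.+1 (y g)) g) xz.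
by rewrite scalerDr -addrA addrK addrCA addNr addr0.
Qed.

(** The walk in the other direction: [x] is the [K]-coboundary of [y], and the diagonal of the
    [G]-coboundary of [y] is again a coboundary. At [b = 0] the values of [x] are constant and [z]
    is the primitive. On the way back, [y] minus the [K]-coboundary of [e] is closed in its column,
    and its primitive [f] is the one sought for [x]. *)
Lemma zigzag_inj a b x z : bicochain a.+1 b.+1 x ->
  (forall g, diff a.+1 x g = 0) -> (forall g y, diff b.+1 (x g) y = 0) ->
  gcochain (a + b) z -> (forall g, diagonal a x g = diff (a + b) z g) ->
  exists2 e, bicochain a b e & forall g, x g = diff b (diff a e g).
Proof.
elim: b a x z => [|b IHb] a x z xg x1 x2 zg xz.
  rewrite addn0 in zg xz; have [zn _ ze] := zg.
  exists (fun g _ => z g).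
    split; first by move=> g g' gg'; apply/funext => y; exact: zn.
      by move=> g; exists 0%N.
    by move=> h Hh g; apply/funext => y; rewrite ze.
  move=> g; apply/funext => y /=; rewrite diff1_eval -xz.
  by apply: diff1_const => //; exact: locally_constant_depends (adapted_val xg g).
have [y yg yx] := row_exact xg x2.
have yd := adapted_dep yg.
have dyg : bicochain a.+2 b.+1 (diff a.+1 y) by exact: bicochain_diff1.
pose s : F := (-1) ^+ a.
have [||||e eg ye] := IHb a.+1 _ (fun g => diagonal a y g - s *: z g) dyg.
- by move=> g; exact: diff_diff.
- move=> g k; rewrite -diff12C.
  have -> : (fun g => diff b.+1 (y g)) = x by apply/funext.
  by rewrite x1.
- rewrite addSn; apply: gcochainB; first exact: gcochain_diagonal.
  by rewrite -addnS; exact: gcochainZ.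
- move=> g; rewrite addSn diffB diff_scale.
  rewrite diff_diagonal//.
  have -> : (fun g => diff b.+1 (y g)) = x by apply/funext.
  by rewrite xz -addnS addrK.
have [||f fg yf] := @column_exact a b (fun g => y g - diff b (e g)).
- by apply: bicochainB => //; exact: bicochain_diff2.
- by move=> g; rewrite diffB diff12C ye subrr.
exists f => // g; rewrite -yx yf.
by rewrite diff2_fun; apply/funext => k; rewrite -[RHS]/(_ - diff b.+1 (diff b (e g)) k) diff_diff subr0.
Qed.

(** [z] enters the double complex as constant functions of one element of [K]. *)
Lemma cocycle_extend n z : gcochain n.+1 z -> (forall g, diff n.+1 z g = 0) ->
  exists w y, [/\ M n.+1 w, forall k, actK k w = w, forall x, diff n.+1 w x = 0,
    gcochain n y &
    (forall g, z g = w (phi \o g) + diff n y g) /\ (n = 0%N -> y = (fun=> 0))].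
Proof.
move=> [zn _ ze] z0.
have [||g x|w [y [Mw wG w0 yg [zy y0]]]] := @zigzag_surj n 0 (fun g _ => z g).
- split; first by move=> g g' gg'; apply/funext => x; exact: zn.
    by move=> g; exists 0%N.
  by move=> h Hh g; apply/funext => x; rewrite ze.
- by move=> g; apply/funext => x; rewrite diff1_eval z0.
- exact: subrr.
rewrite addn0 in Mw w0 yg zy.
by exists w, y; split=> // k; exact: dense_invariant Mw wG k.
Qed.

(** [w] enters the double complex as a constant function of one element of [G]. *)
Lemma coboundary_extend n w z : M n.+2 w -> (forall k, actK k w = w) ->
  (forall x, diff n.+2 w x = 0) -> gcochain n.+1 z ->
  (forall g, w (phi \o g) = diff n.+1 z g) ->
  exists e, [/\ M n.+1 e, forall k, actK k e = e & forall x, w x = diff n.+1 e x].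
Proof.
move=> Mw wK w0 zg wz.
have [||g x||e eg we] := @zigzag_inj 0 n.+1 (fun=> w) z _ _ _ zg.
- by split=> // h _ g; rewrite -[RHS]/(actK _ w) wK.
- by move=> g; exact: subrr.
- exact: w0.
- exact: wz.
exists (e (fun=> 1%g)); split.
- exact: adapted_val eg _.
- apply: (dense_invariant (adapted_val eg _)) => g.
  by rewrite -(adapted_eqv eg)//; apply: (adapted_dep eg).
- by move=> x; rewrite {1}(we (fun=> 1%g)).
Qed.

Lemma degree0_inj w : M 1 w -> (forall g, w (phi \o g) = 0) -> forall x, w x = 0.
Proof.
move=> [s ws] w0 x; have [g gx] := phi_dense s (x 0%N).
by rewrite (ws x (phi \o (fun=> g))) ?w0// => -[].
Qed.

End Zigzag.
End DenseMap.

(** * Unipotent groups of rational matrices *)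

Lemma invmx_mul (R : comUnitRingType) n (a b : 'M[R]_n) :
  a \in unitmx -> b \in unitmx -> invmx (a *m b) = invmx b *m invmx a.
Proof.
move=> au bu; have abu : a *m b \in unitmx by rewrite unitmx_mul au.
apply: (can_inj (mulKmx abu)).
by rewrite mulmxV// !mulmxA mulmxK// mulmxV.
Qed.

Definition lower_unitriangular (R : pzSemiRingType) n (a : 'M[R]_n) :=
  forall i j : 'I_n, (i <= j)%N -> a i j = (i == j)%:R.

(** * Kolchin's theorem in characteristic 0 *)

Section Kolchin.
Variable F : numFieldType.

(** The two factors of the rank factorization of [e], multiplied in reverse order, give the identity
    of size [\rank e]. *)
Lemma idempotent_trace n (e : 'M[F]_n) : e *m e = e -> \tr e = (\rank e)%:R.
Proof.
move=> ee; rewrite -[in LHS](mulmx_base e) mxtrace_mulC.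
suff -> : row_base e *m col_base e = 1%:M by rewrite mxtrace1.
apply: (row_full_inj (col_base_full e)); apply: (row_free_inj (row_base_free e)).
by rewrite mulmx1 mulmx_base mulmxA mulmx_base -mulmxA mulmx_base ee.
Qed.

(** ['X - a] divides ['X^k - a^k]; taking determinants, the characteristic polynomial divides a
    power of ['X]. *)
Lemma nilpotent_trace n (a : 'M[F]_n) k : a ^+ k = 0 -> \tr a = 0.
Proof.
case: n a => [|n] a ak; first by rewrite /mxtrace big_ord0.
have := char_poly_trace a isT => /= tra.
suff cE : char_poly a = 'X^(n.+1).
  by apply/eqP; rewrite -oppr_eq0 -tra cE coefXn ltn_eqF.
have : (char_poly a %| ('X - 0%:P) ^+ (k * n.+1))%R.
  rewrite polyC0 subr0 exprM; have comma : GRing.comm ('X%:M) (map_mx polyC a).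
    by apply/esym; exact: scalar_mxC.
  have := subrXX_comm k comma.
  have -> : map_mx polyC a ^+ k = 0 by rewrite -rmorphXn ak /= map_mx0.
  rewrite subr0 => /(congr1 determinant).
  rewrite detM -/(char_poly a) -rmorphXn /= det_scalar => ->.
  exact: dvdp_mulIl.
move=> /dvdp_exp_XsubCP[j _].
rewrite polyC0 subr0 eqp_monic ?char_poly_monic ?monicXn// => /eqP conjQ.
have := size_char_poly a; rewrite conjQ size_polyXn => -[<-] //.
Qed.

Lemma subspace_mx n (S : set 'rV[F]_n) : S 0 ->
  (forall c u v, S u -> S v -> S (c *: u + v)) ->
  exists W : 'M[F]_n, forall u, (u <= W)%MS <-> S u.
Proof.
move=> S0 SL.
have ex : exists r : nat, `[< exists W : 'M[F]_n, \rank W = r /\ forall u : 'rV_n, (u <= W)%MS -> S u >].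
  exists 0%N; apply/asboolP; exists 0; split; first exact: mxrank0.
  by move=> u; rewrite submx0 => /eqP ->.
have bd r : `[< exists W : 'M[F]_n, \rank W = r /\ forall u : 'rV_n, (u <= W)%MS -> S u >] -> (r <= n)%N.
  by move=> /asboolP[W [<- _]]; exact: rank_leq_col.
case: (ex_maxnP ex bd) => r /asboolP[W [Wr WS]] rmax.
exists W => u; split; first exact: WS.
move=> Su; apply: contraT => uW.
have /rmax : `[< exists W' : 'M[F]_n, \rank W' = \rank (W + u)%MS /\
    forall u : 'rV_n, (u <= W')%MS -> S u >].
  apply/asboolP; exists (W + u)%MS; split=> // w /sub_addsmxP[[a b]] /= ->.
  have [c ->] : exists c, b *m u = c *: u.
    by exists (b 0 0); rewrite {1}[b]mx11_scalar mul_scalar_mx.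
  by rewrite addrC; apply: SL => //; apply: WS; exact: submxMl.
rewrite -Wr leqNgt => /negP[]; apply: rank_ltmx.
rewrite ltmxE addsmxSl /= addsmx_sub submx_refl; exact: uW.
Qed.

(* For an idempotent the trace is the rank, so an algebra of trace zero matrices
   has no element with a nonzero eigenvalue. *)
Lemma trace0_no_fixed_vector n (I : set 'M[F]_n) :
  (forall c a b, I a -> I b -> I (c *: a + b)) ->
  (forall a b, I a -> I b -> I (a *m b)) -> (forall a, I a -> \tr a = 0) ->
  forall a (v : 'rV_n), I a -> v *m a = v -> v = 0.
Proof.
case: n I => [|n] I IL IM I0 a v Ia va; first by apply/rowP => -[].
have IZ c b : I b -> I (c *: b).
  move=> Ib; have -> : c *: b = (c - 1) *: b + b by rewrite scalerBl scale1r subrK.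
  exact: IL.
have IX r : I (a *m horner_mx a r).
  elim/poly_ind: r => [|r c Ir]; first by rewrite raddf0 mulmx0 -(scale0r a); exact: IZ.
  rewrite rmorphD rmorphM /= horner_mx_X horner_mx_C mulmxDr mul_mx_scalar.
  rewrite addrC; apply: IL => //.
  by rewrite -[_ * a]/(_ *m a) mulmxA; exact: IM.
have vX r : v *m horner_mx a r = r.[1] *: v.
  elim/poly_ind: r => [|r c vr]; first by rewrite raddf0 mulmx0 horner0 scale0r.
  rewrite rmorphD rmorphM /= horner_mx_X horner_mx_C mulmxDr -[_ * a]/(_ *m a).
  by rewrite mulmxA vr -scalemxAl va mul_mx_scalar -scalerDl !hornerE.
have [m [q + cE]] := multiplicity_XsubC (char_poly a) 0.
rewrite monic_neq0 ?char_poly_monic//= => q0.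
have : coprimep q (('X - 0%:P) ^+ m.+1) by rewrite coprimep_expr// coprimep_XsubC.
move=> /Bezout_eq1_coprimepP[[u w] /=]; rewrite polyC0 subr0 in cE * => uw.
(* The projection onto the part where [a] is invertible, [m] being the multiplicity of the root 0.
   The exponent [m.+1] supplies, even for [m = 0], the factor [a] that puts [e] in [I]. *)
pose e := horner_mx a (w * 'X^(m.+1)).
have Ie : I e.
  rewrite /e exprS mulrCA rmorphM /= horner_mx_X; exact: IX.
have ee : e *m e = e.
  apply/eqP; rewrite -subr_eq0 -[X in _ - X]mulmx1 -mulmxBr.
  have -> : e - 1%:M = - horner_mx a (u * q).
    have -> : 1%:M = horner_mx a (u * q) + e by rewrite -rmorphD uw !rmorph1.
    by rewrite opprD addrCA subrr addr0.
  rewrite mulmxN -[_ *m _]/(e * _) -rmorphM /=.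
  have -> : w * 'X^(m.+1) * (u * q) = (w * 'X * u) * char_poly a.
    by rewrite cE exprS -!mulrA; do 2!congr (_ * _); rewrite mulrCA [q * _]mulrC mulrA.
  by rewrite (rmorphM (horner_mx a)) /= Cayley_Hamilton mulr0 oppr0.
have e0 : e = 0.
  by apply/eqP; rewrite -mxrank_eq0 -(eqr_nat F) -idempotent_trace// I0.
have [//|v0] := eqVneq v 0.
have q1 : q.[1] = 0.
  have := vX (char_poly a); rewrite Cayley_Hamilton mulmx0 => /esym/eqP.
  by rewrite scaler_eq0 (negPf v0) orbF cE !hornerE expr1n mulr1 => /eqP.
have := vX (w * 'X^(m.+1)); rewrite -/e e0 mulmx0.
have -> : w * 'X^(m.+1) = 1 - u * q by rewrite -uw addrC addKr.
by rewrite !hornerE q1 mulr0 subr0 scale1r => <-.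
Qed.

(** For [v] nonzero in a minimal stable subspace, [v I] is stable, hence 0 or the whole subspace. In
    the second case it contains [v], so an element of [I] fixes [v]. *)
Lemma trace0_common_kernel n (I : set 'M[F]_n.+1) :
  I 0 -> (forall c a b, I a -> I b -> I (c *: a + b)) ->
  (forall a b, I a -> I b -> I (a *m b)) -> (forall a, I a -> \tr a = 0) ->
  exists2 v : 'rV_n.+1, v != 0 & forall a, I a -> v *m a = 0.
Proof.
move=> IO IL IM I0; have Ifix := trace0_no_fixed_vector IL IM I0.
pose stable (W : 'M[F]_n.+1) := forall a, I a -> (W *m a <= W)%MS.
have ex : exists r : nat, `[< (0 < r)%N /\ exists2 W, stable W & \rank W = r >].
  exists n.+1; apply/asboolP; split=> //; exists 1%:M; last exact: mxrank1.
  by move=> a _; exact: submx1.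
case: (ex_minnP ex) => r /asboolP[r0 [W Wst Wr]] rmin.
have W0 : W != 0 by rewrite -mxrank_eq0 Wr -lt0n.
pose v := nz_row W; have v0 : v != 0 by rewrite nz_row_eq0.
have [] := pselect (forall a, I a -> v *m a = 0); first by exists v.
move=> /existsNP[a0 /not_implyP[Ia0 va0]]; exfalso.
have [||W' W'P] := @subspace_mx n.+1 [set u | exists2 a, I a & u = v *m a].
- by exists 0 => //; rewrite mulmx0.
- move=> c u w [a Ia ->] [b Ib ->]; exists (c *: a + b); first exact: IL.
  by rewrite mulmxDr scalemxAr.
have W'st : stable W'.
  move=> a Ia; apply/row_subP => i; rewrite row_mul; apply/W'P.
  have /W'P[b Ib ->] := row_sub i W'.
  by exists (b *m a); [exact: IM|rewrite mulmxA].
have W'W : (W' <= W)%MS.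
  apply/row_subP => i; have /W'P[b Ib ->] := row_sub i W'.
  by apply: submx_trans (Wst _ Ib); apply: submxMr; exact: nz_row_sub.
have W'0 : W' != 0.
  apply/eqP => W'0; apply: va0; have /W'P : exists2 a, I a & v *m a0 = v *m a by exists a0.
  by rewrite W'0 submx0 => /eqP.
have : (v <= W')%MS.
  suff : (W <= W')%MS by apply: submx_trans; exact: nz_row_sub.
  rewrite -(geq_leqif (mxrank_leqif_sup W'W)) Wr; apply: rmin.
  apply/asboolP; split; first by rewrite lt0n mxrank_eq0.
  by exists W'.
move=> /W'P[a Ia va]; move: v0; rewrite (Ifix a v Ia (esym va)).
by rewrite eqxx.
Qed.

(** The span of the [g - 1] consists of matrices of trace 0 and is closed under products, since [(x
    - 1)(y - 1) = (xy - 1) - (x - 1) - (y - 1)]. *)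
Lemma unipotent_fixed_vector n (S : set 'M[F]_n.+1) :
  (forall g h, S g -> S h -> S (g *m h)) ->
  (forall g, S g -> exists k, (g - 1%:M) ^+ k = 0) ->
  exists2 v : 'rV_n.+1, v != 0 & forall g, S g -> v *m g = v.
Proof.
move=> SM Su.
pose I : set 'M[F]_n.+1 := [set a | exists s : seq (F * 'M[F]_n.+1),
  (forall x, x \in s -> S x.2) /\ a = \sum_(x <- s) x.1 *: (x.2 - 1%:M)].
have IL c a b : I a -> I b -> I (c *: a + b).
  move=> [s [sS ->]] [t [tS ->]]; exists ([seq (c * x.1, x.2) | x <- s] ++ t); split.
    move=> x; rewrite mem_cat => /orP[/mapP[y ys ->]|]; [exact: (sS y)|exact: tS].
  rewrite big_cat big_map scaler_sumr; congr (_ + _).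
  by apply: eq_bigr => x _; rewrite scalerA.
have IO : I 0 by exists [::]; split; [move=> x; by rewrite in_nil|by rewrite big_nil].
have IS g : S g -> I (g - 1%:M).
  move=> Sg; exists [:: (1, g)]; rewrite big_seq1 scale1r; split=> // x.
  by rewrite inE => /eqP ->.
have ID a b : I a -> I b -> I (a + b) by move=> Ia Ib; rewrite -[a]scale1r; exact: IL.
have IZ c a : I a -> I (c *: a) by move=> Ia; rewrite -[_ *: _]addr0; exact: IL.
have Isum (J : Type) (r : seq J) (P : pred J) (f : J -> 'M[F]_n.+1) :
    (forall j, P j -> I (f j)) -> I (\sum_(j <- r | P j) f j).
  by move=> If; elim/big_ind: _.
have IM a b : I a -> I b -> I (a *m b).
  move=> [s [sS ->]] [t [tS ->]].
  rewrite mulmx_suml big_seq; apply: (Isum) => x xs.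
  rewrite mulmx_sumr big_seq; apply: Isum => y yt.
  rewrite -scalemxAl -scalemxAr; do 2!apply: (IZ _ _).
  have -> : (x.2 - 1%:M) *m (y.2 - 1%:M) =
      (x.2 *m y.2 - 1%:M) + ((-1) *: (x.2 - 1%:M) + (-1) *: (y.2 - 1%:M)).
    rewrite mulmxBl mul1mx mulmxBr mulmx1 !scaleN1r !opprB [RHS]addrA.
    by congr (_ + _); rewrite addrA subrK.
  apply: (ID); first by apply/IS/SM; [exact: sS|exact: tS].
    by apply: (ID); apply: (IZ); apply: (IS); [exact: (sS x)|exact: (tS y)].
have I0 a : I a -> \tr a = 0.
  move=> [s [sS ->]]; rewrite raddf_sum /= big_seq big1// => x xs.
  have [k xk] := Su _ (sS _ xs).
  by rewrite mxtraceZ (nilpotent_trace xk) mulr0.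
have [v v0 vI] := trace0_common_kernel IO IL IM I0.
exists v => // g /IS/vI; rewrite mulmxBr mulmx1 => /eqP.
by rewrite subr_eq0 => /eqP.
Qed.

(** Only positive powers have the block form, hence [k.+1]. *)
Lemma nilpotent_block m k (c : 'M[F]_(m, 1)) (d : 'M[F]_m) :
  (block_mx 0 0 c d : 'M_(1 + m)) ^+ k = 0 -> d ^+ k.+1 = 0.
Proof.
set a := block_mx _ _ _ _ => ak.
have [e aE] : exists e, a ^+ k.+1 = block_mx 0 0 e (d ^+ k.+1).
  elim: k {ak} => [|k [e aE]]; first by exists c; rewrite !expr1.
  exists (c *m 0 + d *m e); rewrite exprS aE -[a * _]/(a *m _) mulmx_block.
  by rewrite !mul0mx !mulmx0 !addr0 !add0r [d ^+ k.+2]exprS -[d * _]/(d *m _).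
move: aE; rewrite exprS ak mulr0 => /(congr1 drsubmx).
by rewrite block_mxKdr => <-; apply/matrixP => i j; rewrite !mxE.
Qed.

Lemma lower_unitriangular_block m (c : 'M[F]_(m, 1)) (d : 'M[F]_m) :
  lower_unitriangular d ->
  lower_unitriangular (block_mx 1%:M 0 c d : 'M_(1 + m)).
Proof.
move=> dl i j; case: (split_ordP i) => i' ->; case: (split_ordP j) => j' -> ij.
- by rewrite block_mxEul !mxE (inj_eq (@lshift_inj _ _)).
- by rewrite block_mxEur mxE eq_lrshift.
- by move: ij; rewrite [j']ord1.
- rewrite block_mxEdr dl ?(inj_eq (@rshift_inj _ _))//.
Qed.

Lemma unipotent_triangularizable n (S : set 'M[F]_n) :
  (forall g h, S g -> S h -> S (g *m h)) ->
  (forall g, S g -> exists k, (g - 1%:M) ^+ k = 0) ->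
  exists2 P, P \in unitmx & forall g, S g -> lower_unitriangular (P *m g *m invmx P).
Proof.
elim: n S => [|m IHm] S SM Su; first by exists 1%:M; [exact: unitmx1|by move=> g _ []].
have [v v0 vS] := unipotent_fixed_vector SM Su.
(* An invertible matrix whose first row is proportional to [v]. *)
pose P0 := row_ebase v : 'M_(1 + m); have P0u : P0 \in unitmx := row_ebase_unit v.
have P0S g : S g -> row 0 P0 *m g = row 0 P0.
  move=> Sg; have := mulmx_ebase v; rewrite rank_rV v0 [col_ebase v]mx11_scalar.
  have -> : pid_mx 1 = delta_mx 0 0 :> 'M[F]_(1, m.+1).
    by apply/matrixP => i j; rewrite !mxE [i]ord1 eq_sym andbT.
  set c := col_ebase v 0 0; rewrite mul_scalar_mx -scalemxAl -rowE => cv.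
  have c0 : c != 0 by apply: contra_neq v0 => c0; rewrite -cv c0 scale0r.
  by apply: (scalerI c0); rewrite scalemxAl cv vS.
have gE g : S g -> P0 *m g *m invmx P0 = block_mx 1%:M 0
    (dlsubmx (P0 *m g *m invmx P0)) (drsubmx (P0 *m g *m invmx P0)).
  move=> Sg.
  have r0 j : (P0 *m g *m invmx P0) (lshift m 0) j = (lshift m 0 == j)%:R.
    have -> : lshift m (0 : 'I_1) = 0 by apply: ord_inj.
    transitivity ((row 0 (P0 *m g *m invmx P0)) 0 j); first by rewrite [RHS]mxE.
    by rewrite !row_mul P0S// -row_mul mulmxV// !mxE.
  move: (P0 *m g *m invmx P0) r0 => a r0; rewrite -[LHS]submxK.
  congr block_mx; apply/matrixP => i j; rewrite !mxE [i]ord1 r0.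
    by rewrite [j]ord1 eqxx.
  by rewrite eq_lrshift.
have [||P1 P1u P1S] := IHm [set drsubmx (P0 *m g *m invmx P0) | g in S].
- move=> _ _ [g Sg <-] [h Sh <-]; exists (g *m h); first exact: SM.
  have -> : P0 *m (g *m h) *m invmx P0 = (P0 *m g *m invmx P0) *m (P0 *m h *m invmx P0).
    by rewrite !mulmxA mulmxKV.
  rewrite -{1}[P0 *m g *m invmx P0]submxK [P0 *m h *m invmx P0]gE//.
  by rewrite mulmx_block !block_mxKdr mulmx0 add0r.
- move=> _ [g Sg <-]; have [k gk] := Su _ Sg; exists k.+1.
  have conj1 : P0 *m g *m invmx P0 - 1%:M = P0 *m (g - 1%:M) *m invmx P0.
    by rewrite mulmxBr mulmx1 mulmxBl mulmxV.
  have conjX j : P0 *m (g - 1%:M) ^+ j *m invmx P0 = (P0 *m g *m invmx P0 - 1%:M) ^+ j.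
    elim: j => [|j IHj]; first by rewrite !expr0 mulmx1 mulmxV.
    by rewrite !exprS -IHj conj1 -![_ * _]/(_ *m _) !mulmxA mulmxKV.
  move: (conjX k); rewrite gk mulmx0 mul0mx gE//.
  rewrite (@scalar_mx_block _ 1 m) opp_block_mx add_block_mx !subrr !oppr0 !addr0.
  by rewrite block_mxKdr => /esym/nilpotent_block.
pose P := (block_mx 1%:M 0 0 P1 : 'M_(1 + m)) *m P0.
have bu : (block_mx 1%:M 0 0 P1 : 'M_(1 + m)) \in unitmx.
  by rewrite unitmxE det_ublock det1 mul1r -unitmxE.
exists P; first by rewrite unitmx_mul bu P0u.
move=> g Sg.
have -> : P *m g *m invmx P = (block_mx 1%:M 0 0 P1 : 'M_(1 + m)) *m
    (P0 *m g *m invmx P0) *m (block_mx 1%:M 0 0 (invmx P1) : 'M_(1 + m)).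
  have -> : (block_mx 1%:M 0 0 (invmx P1) : 'M_(1 + m)) = invmx (block_mx 1%:M 0 0 P1).
    apply: (row_full_inj (A := (block_mx 1%:M 0 0 P1 : 'M_(1 + m)))).
      by rewrite row_full_unit.
    rewrite mulmxV// mulmx_block !mulmx0 !mul0mx mulmx1 mulmxV//.
    by rewrite !addr0 !add0r -scalar_mx_block.
  by rewrite /P invmx_mul// !mulmxA.
rewrite gE// !mulmx_block !(mulmx0, mul0mx, mul1mx, mulmx1, addr0, add0r).
by apply: lower_unitriangular_block; apply: P1S; exists g.
Qed.

End Kolchin.

Definition common_denominator n (S : set 'M[rat]_n) :=
  exists2 D : nat, (0 < D)%N & forall g, S g -> forall i j, D%:R * g i j \is a Num.int.

Lemma matrix_denominator m n (a : 'M[rat]_(m, n)) :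
  exists2 D : nat, (0 < D)%N & forall i j, D%:R * a i j \is a Num.int.
Proof.
exists (\prod_i \prod_j `|denq (a i j)|)%N.
  by rewrite prodn_gt0// => i; rewrite prodn_gt0// => j; rewrite absz_gt0 denq_eq0.
move=> i j; rewrite (bigD1 i)//= (bigD1 j)//= -mulnA natrM mulrAC.
apply: rpredM; last exact: natr_int.
by rewrite pmulrn absz_denq mulrC -numqE intr_int.
Qed.

(** Conjugation by the diagonal matrix of the [D^i] multiplies the entry [(i, j)] by [D^(i - j)]:
    this clears a common denominator [D] below the diagonal and keeps the diagonal. *)
Lemma unitriangular_integral n (S : set 'M[rat]_n) :
  (forall g h, S g -> S h -> S (g *m h)) ->
  (forall g, S g -> exists k, (g - 1%:M) ^+ k = 0) -> common_denominator S ->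
  exists2 P, P \in unitmx & forall g, S g ->
    lower_unitriangular (P *m g *m invmx P) /\
    forall i j, (P *m g *m invmx P) i j \is a Num.int.
Proof.
move=> SM Su [D0 D0_gt0 SD0]; have [P Pu PS] := unipotent_triangularizable SM Su.
have [D1 D1_gt0 D1P] := matrix_denominator P.
have [D2 D2_gt0 D2P] := matrix_denominator (invmx P).
pose D := (D1 * D0 * D2)%N; have D_gt0 : (0 < D)%N by rewrite !muln_gt0 D1_gt0 D0_gt0.
have D_neq0 : D%:R != 0 :> rat by rewrite pnatr_eq0 -lt0n.
have DP g i j : S g -> D%:R * (P *m g *m invmx P) i j \is a Num.int.
  move=> Sg; rewrite mxE mulr_sumr rpred_sum// => k _.
  rewrite /D natrM mulrACA; apply: rpredM => //.
  rewrite mxE mulr_sumr rpred_sum// => l _.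
  by rewrite natrM mulrACA; apply: rpredM => //; exact: SD0.
pose d : 'rV[rat]_n := \row_i D%:R ^+ i; pose d' : 'rV[rat]_n := \row_i D%:R ^- i.
have dd' : diag_mx d *m diag_mx d' = 1%:M.
  apply/matrixP => i j; rewrite mul_diag_mx !mxE.
  by case: eqVneq => [->|]; rewrite ?mulr1n ?mulr0n ?mulr0// divff// expf_neq0.
have du : diag_mx d \in unitmx by have [] := mulmx1_unit dd'.
have dV : invmx (diag_mx d) = diag_mx d' by rewrite -[LHS]mulmx1 -dd' mulKmx.
exists (diag_mx d *m P); first by rewrite unitmx_mul du.
move=> g Sg.
have E i j : (diag_mx d *m P *m g *m invmx (diag_mx d *m P)) i j =
    D%:R ^+ i * (P *m g *m invmx P) i j * D%:R ^- j.
  rewrite invmx_mul// dV -!mulmxA mul_diag_mx mxE !mulmxA mul_mx_diag mxE !mxE.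
  by rewrite mulrA.
have low := PS g Sg; split=> i j; rewrite E.
  move=> ij; rewrite low//; case: eqVneq => [->|_]; last by rewrite mulr0 mul0r.
  by rewrite mulr1 divff// expf_neq0.
have [ij|ji] := leqP i j.
  rewrite low//; case: eqVneq => [->|_]; last by rewrite mulr0 mul0r.
  by rewrite mulr1 divff ?expf_neq0.
rewrite mulrAC -expfB// -(subnSK ji) exprSr -mulrA.
by apply: rpredM; [rewrite rpredX// natr_int|exact: DP].
Qed.

(** * Compact groups with a normal filtration *)

(** Compactness as near covering, along the filter of finite lists ordered by inclusion. *)
Lemma compact_finite_net (T : topologicalType) (S : set T) (close : T -> set T) :
  compact S -> (forall x, S x -> nbhs x (close x)) ->
  exists r : seq T, forall y, S y -> exists2 x, x \in r & close x y.
Proof.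
move=> S_compact close_nbhs.
pose F := filter_from [set: seq T] (fun r0 => [set r : seq T | {subset r0 <= r}]).
have FF : Filter F.
  apply: filter_from_filter; first by exists [::].
  move=> r r' _ _; exists (r ++ r') => // t rt.
  by split=> x xr; apply: rt; rewrite mem_cat xr ?orbT.
have := (compact_near_coveringP S).1 S_compact _ F
  (fun r y => exists2 x, x \in r & close x y) FF.
case=> [x Sx|r _ rP]; last by exists r; exact: (rP r).
exists (close x, [set r : seq T | x \in r]); last by move=> [y r] /= [xy xr]; exists x.
split=> /=; first exact: close_nbhs.
by exists [:: x] => // r; apply; rewrite inE.
Qed.

Section UniformConstancy.
Variables (K : preTopologicalGroupType) (U : nat -> set K).
Hypothesis UM : forall s u v, U s u -> U s v -> U s (u * v)%g.
Hypothesis U_mono : forall s s' u, (s <= s')%N -> U s' u -> U s u.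
Hypothesis U_nbhs : forall s (x : K), nbhs x [set y | U s (x^-1 * y)%g].
Hypothesis U_base : forall (x : K) A, nbhs x A ->
  exists s, forall y, U s (x^-1 * y)%g -> A y.
Hypothesis K_compact : compact [set: K].

Lemma compact_finite_cosets s : exists r : seq K,
  forall x, exists2 y, y \in r & U s (y^-1 * x)%g.
Proof.
have [r rP] := compact_finite_net K_compact (fun x _ => U_nbhs s x).
by exists r => x; exact: rP.
Qed.

Lemma nbhs_ptws (m : nat) (x : 'I_m -> K) (A : set ('I_m -> K)) :
  nbhs (x : {ptws 'I_m -> K}) A ->
  exists s, forall y, (forall k, U s ((x k)^-1 * y k)%g) -> A y.
Proof.
move=> xA.
pose F : set_system {ptws 'I_m -> K} := filter_from [set: nat]
  (fun s => [set y | forall k, U s ((x k)^-1 * y k)%g]).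
have FF : Filter F.
  apply: filter_from_filter; first by exists 0%N.
  move=> s s' _ _; exists (maxn s s') => // y yP; split=> k.
    by apply: U_mono (yP k); exact: leq_maxl.
  by apply: U_mono (yP k); exact: leq_maxr.
have : F --> (x : {ptws 'I_m -> K}).
  apply/cvg_sup => i B [_ [[C Cop <-] Cx CB]].
  have [s sC] : exists s, forall y, U s ((x i)^-1 * y)%g -> C y.
    by apply: U_base; apply: open_nbhs_nbhs.
  by exists s => // y yP; apply: CB; apply: sC.
by move=> /(_ A xA)[s _ sA]; exists s.
Qed.

Lemma ptws_nbhs (m : nat) (x : 'I_m -> K) s :
  nbhs (x : {ptws 'I_m -> K}) [set y | forall k, U s ((x k)^-1 * y k)%g].
Proof.
apply: (@filter_forall {ptws 'I_m -> K} _
  (fun k => [set y | U s ((x k)^-1 * y k)%g]) (nbhs (x : {ptws 'I_m -> K}))) => k.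
exact: (@proj_continuous 'I_m (fun=> K) k x _ (U_nbhs s (x k))).
Qed.

(** The power of [K] is compact by Tychonoff, so the local moduli [s] have a common bound. *)
Lemma continuous_cochain_uniform (F : pzRingType) (V : lmodType F) i (c : cochain K V i) :
  continuous_cochain c <->
  exists s, forall x y, (forall k, U s ((x k)^-1 * y k)%g) -> c x = c y.
Proof.
split=> [cc|[s cs] x A].
  have loc x : exists s, forall y, (forall k, U s ((x k)^-1 * y k)%g) -> c y = c x.
    apply: nbhs_ptws; apply: (cc x [set v | v = c x]).
    exact: (@discrete_set1 (discrete_topology V)).
  have Kc : compact [set: {ptws 'I_i.+1 -> K}].
    have := @tychonoff 'I_i.+1 (fun=> K) (fun=> [set: K]) (fun=> K_compact).
    by congr compact; apply/seteqP; split.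
  have := (compact_near_coveringP _).1 Kc _ \oo
    (fun s x => forall y, (forall k, U s ((x k)^-1 * y k)%g) -> c x = c y) _.
  case=> [x _|s _ sP]; last by exists s => x; apply: (sP s) => /=.
  have [s sx] := loc x.
  exists ([set y | forall k, U s ((x k)^-1 * y k)%g], [set s' | (s <= s')%N]).
    split=> /=; first exact: ptws_nbhs.
    by exists s.
  move=> [x' s'] /= [xx' ss'] y yx'; rewrite !sx// => k.
  have -> : ((x k)^-1 * y k = ((x k)^-1 * x' k) * ((x' k)^-1 * y k))%g.
    by rewrite -mulgA mulVKg.
  by apply: UM => //; apply: U_mono (yx' k).
move=> /nbhs_singleton Ax.
have FF : Filter (nbhs (x : {ptws 'I_i.+1 -> K})) by exact: nbhs_filter.
apply: filterS (ptws_nbhs x s) => y /= xy.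
by rewrite /= -(cs x).
Qed.

Lemma smooth_uniform (F : pzRingType) (V : lmodType F) (rho : representation K V) :
  smooth rho -> forall v, exists s, forall u, U s u -> rho u v = v.
Proof.
move=> rs v; have [|s sP] := @U_base 1%g [set g | rho g v = v].
  by apply: open_nbhs_nbhs; split; [exact: rs|exact: rep_act1].
by exists s => u Uu; apply: sP; rewrite invg1 mul1g.
Qed.

End UniformConstancy.

(** * The p-adic topology *)

Section PadicBalls.
Variable p : prime_number.
Implicit Types (x y : padic p) (s t : nat).

Definition pball s : set (padic p) :=
  [set x | exists2 z, padic_integers z & x = p%:R ^+ s * z].

Lemma pball_integers x : pball 0 x <-> padic_integers x.
Proof. by split=> [[z zZ ->]|xZ]; [rewrite expr0 mul1r|exists x; rewrite ?expr0 ?mul1r]. Qed.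

Lemma pball0 s : pball s 0.
Proof. by exists 0; [exact: padic_integers0|rewrite mulr0]. Qed.

Lemma pballD s x y : pball s x -> pball s y -> pball s (x + y).
Proof.
move=> [z zZ ->] [w wZ ->]; exists (z + w); last by rewrite mulrDr.
exact: padic_integersD.
Qed.

Lemma pballN s x : pball s x -> pball s (- x).
Proof.
by move=> [z zZ ->]; exists (- z); [exact: padic_integersN|rewrite mulrN].
Qed.

Lemma pballM s t x y : pball s x -> pball t y -> pball (s + t) (x * y).
Proof.
move=> [z zZ ->] [w wZ ->]; exists (z * w); first exact: padic_integersM.
by rewrite exprD mulrACA.
Qed.

Lemma pball_mono s t x : (s <= t)%N -> pball t x -> pball s x.
Proof.
move=> /subnKC <- [z zZ ->]; exists (p%:R ^+ (t - s) * z).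
  by apply: padic_integersM => //; apply/padic_integersX/padic_integers_nat.
by rewrite exprD mulrA.
Qed.

Lemma padic_p_neq0 : p%:R != 0 :> padic p.
Proof. by rewrite padic_natr_eq0 -lt0n prime_gt0//; exact: valP p. Qed.

Lemma pball_shift C s x y : padic_integers (p%:R ^+ C * x) -> pball (s + C) y ->
  pball s (x * y).
Proof.
move=> xC [z zZ ->]; exists ((p%:R ^+ C * x) * z); first exact: padic_integersM.
by rewrite exprD -!mulrA mulrCA; congr (_ * _); rewrite mulrCA.
Qed.

Lemma pball_separated x : (forall s, pball s x) -> x = 0.
Proof.
move=> xs; have /pball_integers[a _ ax] := xs 0%N.
rewrite -ax; suff -> : a = 0 by rewrite rmorph0.
apply: padic_eqP => k; have [_ [b _ <-]] := xs k.
rewrite -ax -(rmorph_nat (@FracField.tofrac (padic_int p))) -rmorphXn -rmorphM.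
move=> /eqP; rewrite tofrac_eq => /eqP ->.
rewrite -natrX /= padic_natE mod0z.
have -> : (p ^ k)%N%:Z = p%:Z ^+ k by rewrite -!natz natrX.
by rewrite modzz mul0r !mod0z.
Qed.

Lemma nbhs_pball s x : nbhs x [set y | pball s (y - x)].
Proof.
apply: open_nbhs_nbhs; split; last by rewrite /= subrr; exact: pball0.
rewrite open_padicE => y /= yx; exists s => z zZ /=.
by rewrite addrAC; apply: pballD => //; exists z.
Qed.

Lemma pball_nbhs x A : nbhs x A -> exists s, forall y, pball s (y - x) -> A y.
Proof.
rewrite nbhsE => -[B [oB Bx] BA]; have [s sB] := oB x Bx; exists s => y [z zZ yE].
by apply: BA; rewrite -[y](subrK x) yE addrC; exact: sB.
Qed.

Lemma rat_to_padic_bounded (q : rat) :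
  exists C, padic_integers (p%:R ^+ C * rat_to_padic p q).
Proof.
have p_prime : prime p := valP p.
have d_gt0 : (0 < `|denq q|)%N by rewrite absz_gt0 denq_eq0.
have [m pm dE] := pfactor_coprime p_prime d_gt0.
have [y ym] := padic_int_coprime_unit pm.
exists (logn p `|denq q|).
have -> : p%:R ^+ logn p `|denq q| * rat_to_padic p q =
    (numq q)%:~R * @FracField.tofrac (padic_int p) y.
  have tm : @FracField.tofrac (padic_int p) y * m%:R = 1.
    by rewrite -(rmorph_nat (@FracField.tofrac (padic_int p))) -rmorphM ym rmorph1.
  have m0 : m%:R != 0 :> padic p.
    by apply: contra_eq_neq tm => ->; rewrite mulr0 eq_sym oner_eq0.
  rewrite /rat_to_padic /ratr -[in (denq q)%:~R]absz_denq -pmulrn {2}dE.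
  have -> : @FracField.tofrac (padic_int p) y = m%:R^-1.
    by apply: (mulIf m0); rewrite tm mulVf.
  have cancel (F : fieldType) (u v w : F) : u != 0 -> u * (v / (w * u)) = v / w.
    by move=> u0; rewrite invfM !mulrA mulrC !mulrA mulVf// mul1r.
  rewrite natrM natrX; exact: (cancel _ _ _ _ (expf_neq0 _ padic_p_neq0)).
by apply: (@padic_integersM p); [exact: padic_integers_int|exists y].
Qed.

Lemma padic_intE (m : int) k : (m%:~R : padic_int p) k = (m %% p%:Z ^+ k)%Z.
Proof.
case: m => m; first exact: padic_natE.
by rewrite NegzE mulrNz /= padic_natE modzNm.
Qed.

Lemma rat_to_padic_integersP (q : rat) :
  padic_integers (rat_to_padic p q) -> ~~ (p %| `|denq q|)%N.
Proof.
have p_prime : prime p := valP p.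
move=> [y _ yq]; apply/negP => pd.
have d0 : (denq q)%:~R != 0 :> padic p by apply: denq_char0_neq0; exact: padic_natr_eq0.
have : @FracField.tofrac (padic_int p) (y * (denq q)%:~R) = FracField.tofrac (numq q)%:~R.
  by rewrite (rmorphM (@FracField.tofrac (padic_int p))) !rmorph_int /= yq /rat_to_padic /ratr divfK.
move=> /eqP; rewrite tofrac_eq => /eqP /(congr1 (fun x : padic_int p => x 1%N)) /=.
rewrite !padic_intE expr1 modzMmr.
have /dvdzP[k ->] : (p %| denq q)%Z by rewrite dvdzE.
rewrite mulrA modzMl => /esym/dvdz_mod0P; rewrite dvdzE /= => pn.
have := coprime_num_den q; rewrite /coprime => /eqP g1.
have : (p %| gcdn `|numq q| `|denq q|)%N by rewrite dvdn_gcd pn.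
by rewrite g1 dvdn1 => /eqP p1; rewrite p1 in p_prime.
Qed.

Section Matrices.
Variables m n : nat.
Implicit Types a b : 'M[padic p]_(m, n).

Definition mball s : set 'M[padic p]_(m, n) := [set a | forall i j, pball s (a i j)].

Lemma mball0 s : mball s 0.
Proof. by move=> i j; rewrite mxE; exact: pball0. Qed.

Lemma mballD s a b : mball s a -> mball s b -> mball s (a + b).
Proof. by move=> sa sb i j; rewrite mxE; exact: pballD. Qed.

Lemma mballN s a : mball s a -> mball s (- a).
Proof. by move=> sa i j; rewrite mxE; exact: pballN. Qed.

Lemma mball_mono s t a : (s <= t)%N -> mball t a -> mball s a.
Proof. by move=> st ta i j; exact: pball_mono (ta i j). Qed.

Definition mbounded C a := forall i j, padic_integers (p%:R ^+ C * a i j).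

Lemma mbounded_mono C C' a : (C <= C')%N -> mbounded C a -> mbounded C' a.
Proof.
move=> /subnK <- aC i j; rewrite exprD -mulrA; apply: padic_integersM => //.
by apply/padic_integersX/padic_integers_nat.
Qed.

End Matrices.

Lemma pball_sum s (I : Type) (r : seq I) (P : pred I) (F : I -> padic p) :
  (forall i, P i -> pball s (F i)) -> pball s (\sum_(i <- r | P i) F i).
Proof.
move=> Fs; elim/big_ind: _ => //; [exact: pball0|exact: pballD].
Qed.

Lemma mballM m n r s t (a : 'M_(m, n)) (b : 'M_(n, r)) :
  mball s a -> mball t b -> mball (s + t) (a *m b).
Proof.
by move=> sa tb i j; rewrite mxE; apply: pball_sum => k _; exact: pballM.
Qed.

Lemma mball_shiftl m n r C s (a : 'M_(m, n)) (b : 'M_(n, r)) :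
  mbounded C a -> mball (s + C) b -> mball s (a *m b).
Proof.
move=> aC sb i j; rewrite mxE; apply: pball_sum => k _.
exact: pball_shift (aC i k) (sb k j).
Qed.

Lemma mball_shiftr m n r C s (a : 'M_(m, n)) (b : 'M_(n, r)) :
  mball (s + C) a -> mbounded C b -> mball s (a *m b).
Proof.
move=> sa bC i j; rewrite mxE; apply: pball_sum => k _.
by rewrite mulrC; exact: pball_shift (bC k j) (sa i k).
Qed.

Lemma map_rat_bounded m n (a : 'M[rat]_(m, n)) :
  exists C, mbounded C (map_mx (@rat_to_padic p) a).
Proof.
have /choice[f fP] (ij : 'I_m * 'I_n) : exists C,
    padic_integers (p%:R ^+ C * rat_to_padic p (a ij.1 ij.2)).
  exact: rat_to_padic_bounded.
exists (\max_ij f ij)%N => i j; rewrite mxE.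
rewrite -(subnKC (leq_bigmax (i, j))) addnC exprD -mulrA.
by apply: padic_integersM; [apply/padic_integersX/padic_integers_nat|exact: fP].
Qed.

Lemma nbhs_mball m n s (a : 'M[padic p]_(m, n)) : nbhs a [set b | mball s (b - a)].
Proof.
exists (fun i j => [set y | pball s (y - a i j)]); first by move=> i j; exact: nbhs_pball.
by move=> b sb i j; rewrite !mxE; exact: sb.
Qed.

Lemma mball_nbhs m n (a : 'M[padic p]_(m, n)) A : nbhs a A ->
  exists s, forall b, mball s (b - a) -> A b.
Proof.
move=> [P Pa PA].
have /choice[f fP] (ij : 'I_m * 'I_n) : exists s, forall y,
    pball s (y - a ij.1 ij.2) -> P ij.1 ij.2 y.
  exact: pball_nbhs.
exists (\max_ij f ij)%N => b sb; apply: PA => i j; apply: (fP (i, j)).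
apply: (pball_mono (leq_bigmax (i, j))).
by have := sb i j; rewrite !mxE.
Qed.

Lemma nbhs_GL n s (g : GL n (padic p)) :
  nbhs g [set h : GL n (padic p) | mball s (GL_mx h - GL_mx g)].
Proof.
pose B : set ('M[padic p]_n * 'M[padic p]_n) := [set b | mball s (b.1 - GL_mx g)].
have gB : nbhs (GL_mx g, GL_mx (g^-1)%g) B.
  exists ([set b | mball s (b - GL_mx g)], setT).
    by split; [exact: nbhs_mball|exact: filterT].
  by move=> [b c] [].
exact: (@initial_continuous _ _
  (fun g : GL n (padic p) => (GL_mx g, GL_mx (g^-1)%g)) g B gB).
Qed.

Lemma GL_nbhs n (g : GL n (padic p)) A : nbhs g A -> exists s, forall h : GL n (padic p),
  mball s (GL_mx h - GL_mx g) -> mball s (GL_mx h^-1%g - GL_mx g^-1%g) -> A h.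
Proof.
move=> [_ [[B oB <-] Bg] BA].
have [[B1 B2] /= [/mball_nbhs[s1 sB1] /mball_nbhs[s2 sB2]] B12] :
    nbhs (GL_mx g, GL_mx g^-1%g) B by apply: open_nbhs_nbhs.
exists (maxn s1 s2) => h h1 h2; apply: BA; apply: (B12 (_, _)); split=> /=.
  by apply: sB1; apply: mball_mono h1; exact: leq_maxl.
by apply: sB2; apply: mball_mono h2; exact: leq_maxr.
Qed.

End PadicBalls.

Lemma nbhs_subgroup (G : preTopologicalGroupType) (H : subgroup G) (x : H) A :
  nbhs x A <-> exists2 B, nbhs (val x) B & forall y : H, B (val y) -> A y.
Proof.
split=> [[_ [[C oC <-] Cx] CA]|[B xB BA]].
  by exists C; [exact: open_nbhs_nbhs|exact: CA].
have nB : nbhs x [set y : H | B (val y)] :=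
  @initial_continuous _ _ (set_val : subgroup_set H -> G) x B xB.
by apply: filterS nB => y; exact: BA.
Qed.

Lemma subgroup_compact (G : preTopologicalGroupType) (H : subgroup G) :
  compact (subgroup_set H) -> compact [set: H].
Proof.
move=> Hc F PF _.
have [|y [Hy yF]] := Hc (val @ F) _.
  change (F [set x : H | subgroup_set H (val x)]).
  by apply: filterS filterT => x _ /=; exact: set_mem (valP x).
exists (Sub y (mem_set Hy)); split=> // A B FA /nbhs_subgroup[C yC CB].
have FvA : (val @ F) [set val z | z in A].
  change (F [set x : H | [set val z | z in A] (val x)]).
  by apply: filterS FA => z Az; exists z.
have [_ [[z Az <-] Cz]] := yF _ C FvA yC.
by exists z; split=> //; exact: CB.
Qed.

(** * The congruence filtration of the closure *)

Section Filtration.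
Variables (n : nat) (p : prime_number) (K : subgroup (GL n (padic p))).
Variables (Q Qi : 'M[padic p]_n) (C : nat).
Hypothesis QQi : Q *m Qi = 1%:M.
Hypothesis QiQ : Qi *m Q = 1%:M.
Hypothesis Q_bounded : mbounded C Q.
Hypothesis Qi_bounded : mbounded C Qi.

(** [Q] will be the image of the rational base change. Its denominators and those of its inverse are
    bounded by [p^C], so each conjugation costs [C] twice in precision. *)
Definition conjQ (a : 'M[padic p]_n) := Q *m a *m Qi.

Lemma conjQM a b : conjQ (a *m b) = conjQ a *m conjQ b.
Proof. by rewrite /conjQ !mulmxA -[Q *m a *m Qi *m Q]mulmxA QiQ mulmx1. Qed.

Lemma conjQB a b : conjQ (a - b) = conjQ a - conjQ b.
Proof. by rewrite /conjQ mulmxBr mulmxBl. Qed.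

Lemma conjQ1 : conjQ 1%:M = 1%:M.
Proof. by rewrite /conjQ mulmx1. Qed.

Lemma mball_conjQ s a : mball (s + C + C) a -> mball s (conjQ a).
Proof. by move=> sa; apply: mball_shiftr Qi_bounded; apply: mball_shiftl Q_bounded _. Qed.

Lemma mball_conjQ_inv s a : mball (s + C + C) (conjQ a) -> mball s a.
Proof.
move=> sa; have -> : a = Qi *m conjQ a *m Q.
  by rewrite /conjQ !mulmxA QiQ mul1mx -mulmxA QiQ mulmx1.
by apply: mball_shiftr Q_bounded; apply: mball_shiftl Qi_bounded _.
Qed.

Hypothesis K_integral : forall g : K, mball 0 (conjQ (GL_mx (val g))).

Definition mx_of (g : K) : 'M[padic p]_n := GL_mx (val g).

Lemma mx_ofM g h : mx_of (g * h)%g = mx_of g *m mx_of h.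
Proof. by []. Qed.

Lemma mx_of1 : mx_of 1%g = 1%:M.
Proof. by []. Qed.

(** The principal congruence subgroups of [K], normal because all of [K] is integral after
    conjugation. *)
Definition filtration s : set K := [set g | mball s (conjQ (mx_of g) - 1%:M)].
Local Notation U := filtration.

Lemma filtration1 s : U s 1%g.
Proof. by rewrite /filtration /= mx_of1 conjQ1 subrr; exact: mball0. Qed.

Lemma mballMl s (a b : 'M[padic p]_n) : mball 0 a -> mball s b -> mball s (a *m b).
Proof. by move=> a0 bs; rewrite -[s]add0n; exact: mballM. Qed.

Lemma mballMr s (a b : 'M[padic p]_n) : mball s a -> mball 0 b -> mball s (a *m b).
Proof. by move=> a0 bs; rewrite -[s]addn0; exact: mballM. Qed.

Lemma filtrationM s u v : U s u -> U s v -> U s (u * v)%g.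
Proof.
move=> Uu Uv; rewrite /filtration /= mx_ofM conjQM.
have -> : conjQ (mx_of u) *m conjQ (mx_of v) - 1%:M =
    (conjQ (mx_of u) - 1%:M) *m conjQ (mx_of v) + (conjQ (mx_of v) - 1%:M).
  by rewrite mulmxBl mul1mx addrA subrK.
by apply: mballD; [apply: mballMr; [exact: Uu|exact: K_integral]|exact: Uv].
Qed.

Lemma filtrationV s u : U s u -> U s u^-1%g.
Proof.
move=> Uu; rewrite /filtration /=.
have -> : conjQ (mx_of u^-1%g) - 1%:M = - (conjQ (mx_of u^-1%g) *m (conjQ (mx_of u) - 1%:M)).
  by rewrite mulmxBr mulmx1 -conjQM -mx_ofM mulVg mx_of1 conjQ1 opprB.
by apply: mballN; apply: mballMl => //; exact: K_integral.
Qed.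

Lemma filtrationJ s u x : U s u -> U s (x^-1 * u * x)%g.
Proof.
move=> Uu; rewrite /filtration /=.
have -> : conjQ (mx_of (x^-1 * u * x)%g) - 1%:M =
    conjQ (mx_of x^-1%g) *m (conjQ (mx_of u) - 1%:M) *m conjQ (mx_of x).
  rewrite mulmxBr mulmxBl mulmx1 -!conjQM -!mx_ofM mulVg mx_of1 conjQ1.
  by [].
by apply: mballMr; [apply: mballMl => //|]; exact: K_integral.
Qed.

Lemma filtration_mono s s' u : (s <= s')%N -> U s' u -> U s u.
Proof. by move=> ss'; exact: mball_mono. Qed.

Lemma filtration_coset s (x y : K) : mball s (conjQ (mx_of y - mx_of x)) -> U s (x^-1 * y)%g.
Proof.
move=> sxy; rewrite /filtration /=.
have -> : conjQ (mx_of (x^-1 * y)%g) - 1%:M = conjQ (mx_of x^-1%g) *m conjQ (mx_of y - mx_of x).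
  by rewrite conjQB mulmxBr -!conjQM -!mx_ofM mulVg mx_of1 conjQ1.
by apply: mballMl => //; exact: K_integral.
Qed.

Lemma nbhs_filtration s (x : K) : nbhs x [set y | U s (x^-1 * y)%g].
Proof.
apply/nbhs_subgroup; exists [set h | mball (s + C + C) (GL_mx h - GL_mx (val x))].
  exact: nbhs_GL.
by move=> y /= sy; apply: filtration_coset; exact: mball_conjQ.
Qed.

Lemma filtration_nbhs (x : K) A : nbhs x A ->
  exists s, forall y, U s (x^-1 * y)%g -> A y.
Proof.
move=> /nbhs_subgroup[B /GL_nbhs[t tB] BA]; exists (t + C + C)%N => y Uy.
have valV (z : K) : ((val z)^-1 = val z^-1)%g.
  have zV : (val z^-1 * val z = 1)%g by rewrite -[LHS]/(val (z^-1 * z)%g) mulVg.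
  by apply: (mulIg (val z)); rewrite [RHS]zV mulVg.
apply/BA/tB; rewrite ?valV -!/(mx_of _); apply: mball_conjQ_inv.
  have -> : conjQ (mx_of y - mx_of x) = conjQ (mx_of x) *m (conjQ (mx_of (x^-1 * y)%g) - 1%:M).
    by rewrite mulmxBr mulmx1 -conjQM -mx_ofM mulVKg -conjQB.
  by apply: mballMl; [exact: K_integral|exact: Uy].
have -> : conjQ (mx_of y^-1%g - mx_of x^-1%g) =
    (conjQ (mx_of (x^-1 * y)^-1%g) - 1%:M) *m conjQ (mx_of x^-1%g).
  by rewrite mulmxBl mul1mx -conjQM -mx_ofM invgM invgK mulgK -conjQB.
by apply: mballMr; [exact: filtrationV|exact: K_integral].
Qed.

End Filtration.

(** * Adelic neighbourhoods and bounded denominators *)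

Section Adeles.

Definition adele_proj (p : prime_number) (x : adele) : padic p := x p.

Lemma adele_proj_zmod_morphism p : zmod_morphism (adele_proj p).
Proof. by []. Qed.

Lemma adele_proj_monoid_morphism p : monoid_morphism (adele_proj p).
Proof. by []. Qed.

HB.instance Definition _ p := GRing.isZmodMorphism.Build adele (padic p)
  (adele_proj p) (adele_proj_zmod_morphism p).
HB.instance Definition _ p := GRing.isMonoidMorphism.Build adele (padic p)
  (adele_proj p) (adele_proj_monoid_morphism p).

(** A free [s] serves the continuity of the projection to [p]; [s = 0] measures denominators at all
    primes at once. *)
Definition adele_close p s (x : adele) : set adele :=
  [set y | forall q : prime_number, pball (if q == p then s else 0%N) (y q - x q)].

Lemma nbhs_adele_close p s (x : adele) : nbhs x (adele_close p s x).
Proof.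
apply: open_nbhs_nbhs; split; last by move=> q; rewrite subrr; exact: pball0.
move=> y yx; exists (fun q => [set z | pball (if q == p then s else 0%N) (z - x q)]).
split=> //.
- move=> q; rewrite open_padicE => z /= zx.
  exists (if q == p then s else 0%N) => w wZ /=.
  by rewrite addrAC; apply: pballD => //; exists w.
- apply: (@sub_finite_set _ _ ([set p] `|` [set q | ~ padic_integers (x q)])).
    move=> q /= Wq; apply: contrapT => /not_orP[qp /contrapT xq]; apply: Wq.
    have /negPf -> : q != p by apply/eqP.
    apply/seteqP; split=> z /=.
      by move=> /pball_integers zx; rewrite -[z](subrK (x q)); exact: padic_integersD.
    by move=> zZ; apply/pball_integers; apply: padic_integersD => //; exact: padic_integersN.
  by rewrite finite_setU; split; [exact: finite_set1|exact: adeleP].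
Qed.

Variable n : nat.

Lemma nbhs_GL_adele (p : prime_number) s (g : GL n adele) :
  nbhs g [set h : GL n adele | forall i j, adele_close p s (GL_mx g i j) (GL_mx h i j) /\
    adele_close p s (GL_mx g^-1%g i j) (GL_mx h^-1%g i j)].
Proof.
pose B := [set b : 'M[adele]_n * 'M[adele]_n | forall i j,
  adele_close p s (GL_mx g i j) (b.1 i j) /\ adele_close p s (GL_mx g^-1%g i j) (b.2 i j)].
have gB : nbhs (GL_mx g, GL_mx (g^-1)%g) B.
  exists ([set b : 'M[adele]_n | forall i j, adele_close p s (GL_mx g i j) (b i j)],
          [set b : 'M[adele]_n | forall i j, adele_close p s (GL_mx g^-1%g i j) (b i j)]).
    split; [exists (fun i j => adele_close p s (GL_mx g i j))|
            exists (fun i j => adele_close p s (GL_mx g^-1%g i j))] => // i j;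
      exact: nbhs_adele_close.
  by move=> [b c] [/= b1 c1] i j.
exact: (@initial_continuous _ _
  (fun g : GL n adele => (GL_mx g, GL_mx (g^-1)%g)) g B gB).
Qed.

Lemma GL_proj_continuous p : continuous (GL_map (adele_proj p) : GL n adele -> GL n (padic p)).
Proof.
move=> g A /GL_nbhs[s sA]; apply: filterS (nbhs_GL_adele p s g) => h hg.
apply: sA => i j.
  by have [/(_ p) + _] := hg i j; rewrite eqxx !mxE.
have [_ /(_ p)] := hg i j; rewrite eqxx => hij.
have mV (f : GL n adele) : GL_mx (GL_map (adele_proj p) f)^-1%g = map_mx (adele_proj p) (GL_mx f^-1%g).
  rewrite -[RHS]/(GL_mx (GL_map (adele_proj p) f^-1%g)); congr GL_mx.
  apply: (mulIg (GL_map (adele_proj p) f)); rewrite mulVg -GL_mapM mulVg.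
  by apply: val_inj; rewrite /= map_mx1.
by rewrite !mV !mxE.
Qed.

Lemma GL_padic_hausdorff p : hausdorff_space (GL n (padic p)).
Proof.
move=> g h gh; apply: val_inj; apply/matrixP => i j; apply/eqP; rewrite -subr_eq0; apply/eqP.
apply: pball_separated => s.
have [k [kg kh]] := gh _ _ (nbhs_GL s g) (nbhs_GL s h).
rewrite -[GL_mx g i j](subrK (GL_mx k i j)) -addrA; apply: pballD.
  by rewrite -opprB; apply: pballN; have := kg i j; rewrite !mxE.
by have := kh i j; rewrite !mxE.
Qed.

End Adeles.

Lemma rat_integral (q : rat) :
  (forall p : prime_number, padic_integers (rat_to_padic p q)) -> q \is a Num.int.
Proof.
move=> qZ; rewrite Qint_def -absz_denq eqz_nat; apply: contraT => d1.
have d_pr : prime (pdiv `|denq q|).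
  by apply: pdiv_prime; rewrite ltn_neqAle eq_sym d1 absz_gt0 denq_eq0.
have /rat_to_padic_integersP := qZ (exist (fun p => is_true (prime p)) _ d_pr).
by rewrite /= pdiv_dvd.
Qed.

(** Two rational matrices close to the same adelic one differ by an integral matrix. So one rational
    matrix near each point of a finite net, where there is one, bounds the denominators of all. *)
Lemma compact_common_denominator n (S : set (GL n adele)) : compact S ->
  common_denominator [set GL_mx g | g in [set g : GL n rat | S (GL_map rat_to_adele g)]].
Proof.
(* Any prime would do, as radius 0 is imposed at all of them. *)
move=> Sc; pose p : prime_number := exist (fun p => is_true (prime p)) 2%N isT.
pose close (g h : GL n adele) := forall i j, adele_close p 0 (GL_mx g i j) (GL_mx h i j).
have close_nbhs g : S g -> nbhs g (close g).
  by move=> _; apply: filterS (nbhs_GL_adele p 0 g) => h hg i j; have [] := hg i j.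
have [r rP] := compact_finite_net Sc close_nbhs.
suff [D D_gt0 DP] : exists2 D : nat, (0 < D)%N & forall g, g \in r ->
    forall h : GL n rat, close g (GL_map rat_to_adele h) ->
    forall i j, D%:R * GL_mx h i j \is a Num.int.
  exists D => // _ [h /= Sh <-]; have [g gr gh] := rP _ Sh; exact: DP gr _ gh.
elim: r {rP} => [|g r [D D_gt0 DP]]; first by exists 1%N.
have [[h gh]|Nh] := pselect (exists h : GL n rat, close g (GL_map rat_to_adele h)).
  have [D' D'_gt0 D'P] := matrix_denominator (GL_mx h).
  exists (D * D')%N; first by rewrite muln_gt0 D_gt0.
  move=> g'; rewrite inE => /orP[/eqP ->|g'r] h' gh' i j; last first.
    rewrite mulnC natrM -mulrA; apply: rpredM; first exact: natr_int.
    exact: DP gh' i j.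
  rewrite natrM -mulrA; apply: rpredM; first exact: natr_int.
  rewrite -[GL_mx h' i j](subrK (GL_mx h i j)) mulrDr; apply: rpredD => //.
  apply: rpredM; first exact: natr_int.
  apply: rat_integral => q; rewrite rmorphB /=; apply/pball_integers.
  have := gh' i j q; have := gh i j q; rewrite !mxE !if_same /= => gq gq'.
  have -> : rat_to_padic q (GL_mx h' i j) - rat_to_padic q (GL_mx h i j) =
      (rat_to_padic q (GL_mx h' i j) - GL_mx g i j q) -
      (rat_to_padic q (GL_mx h i j) - GL_mx g i j q).
    by rewrite opprB addrA subrK.
  by apply: pballD => //; exact: pballN.
exists D => // g'; rewrite inE => /orP[/eqP -> h' gh'|]; last exact: DP.
by case: Nh; exists h'.
Qed.

Lemma points_comp n (N : linear_algebraic_group n) (R S : comUnitRingType)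
    (f : {rmorphism rat -> R}) (f' : {rmorphism rat -> S}) (h : {rmorphism R -> S})
    (g : GL n R) : (forall x, f' x = h (f x)) ->
  points N f g -> points N f' (GL_map h g).
Proof.
move=> hf Ng q Eq; have := Ng q Eq.
rewrite /entries_eval /= => /(congr1 h); rewrite rmorph0 => <-.
rewrite /mpoly.mmap rmorph_sum; apply: eq_bigr => m _.
rewrite rmorphM hf; congr (_ * _).
rewrite /mpoly.mmap1 rmorph_prod; apply: eq_bigr => k _.
by rewrite rmorphXn -map_mxvec mxE.
Qed.

Section Closure.
Variables (n : nat) (N : linear_algebraic_group n) (Gamma : subgroup (GL n rat)).
Variables (p : prime_number) (K : subgroup (GL n (padic p))).
Hypothesis GammaN : congruence_subgroup N Gamma.
Hypothesis KE : subgroup_set K = padic_closure N Gamma p.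

(** The projection of the compact adelic group is compact, hence closed, and so contains the closure
    of [Gamma]. It consists of points of [N], so the closure does too. *)
Lemma closure_compact : compact (subgroup_set K).
Proof.
have [K' [K'N K'c _ GE]] := GammaN.
pose Kp := GL_map (adele_proj p) @` subgroup_set K'.
have Kpc : compact Kp.
  by apply: continuous_compact => //; apply: continuous_subspaceT; exact: GL_proj_continuous.
have Kp_closed : closed Kp by apply: compact_closed => //; exact: GL_padic_hausdorff.
have GKp : closure (GL_map (@rat_to_padic p) @` subgroup_set Gamma) `<=` Kp.
  rewrite ((closure_id Kp).1 Kp_closed); apply: closureS => _ [g Gg <-].
  move: Gg; rewrite GE => -[_ K'g]; exists (GL_map rat_to_adele g) => //.
  by apply: val_inj; apply/matrixP => i j; rewrite !mxE.
have KE' : subgroup_set K = closure (GL_map (@rat_to_padic p) @` subgroup_set Gamma).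
  rewrite KE /padic_closure; apply/seteqP; split=> [g []//|g gG]; split=> //.
  have [h K'h <-] := GKp g gG.
  by apply: (points_comp (f := rat_to_adele)) => //; exact: K'N.
rewrite KE'; apply: (subclosed_compact _ Kpc GKp); exact: closed_closure.
Qed.

Lemma closure_approx (g : K) s : exists2 h : GL n rat, subgroup_set Gamma h &
  mball s (GL_mx (GL_map (@rat_to_padic p) h) - GL_mx (val g)).
Proof.
have : closure (GL_map (@rat_to_padic p) @` subgroup_set Gamma) (val g).
  by move: (val g) (set_mem (valP g) : subgroup_set K (val g)) => x; rewrite KE => -[].
move=> /(_ _ (nbhs_GL s (val g)))[_ [[h Gh <-] hg]].
by exists h.
Qed.

End Closure.

Lemma unipotent_rational n (N : linear_algebraic_group n) (g : GL n rat) :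
  unipotent N -> points N (idfun : {rmorphism rat -> rat}) g ->
  exists k, (GL_mx g - 1%:M) ^+ k = 0.
Proof.
move=> Nu Ng.
have [k gk] := Nu _ (points_map (ratr : {rmorphism rat -> algC}) Ng).
exists k; apply: (map_mx_inj (f := ratr : {rmorphism rat -> algC})).
rewrite map_mx0 -gk /=.
have -> : map_mx ratr (GL_mx g) - 1%:M = map_mx (ratr : rat -> algC) (GL_mx g - 1%:M).
  by rewrite map_mxB map_mx1.
elim: k {gk} => [|k IHk]; first by rewrite !expr0 map_mx1.
by rewrite !exprS -IHk -[_ * _ in LHS]/(_ *m _) map_mxM.
Qed.

(** * Coordinates and comparison of cochains *)

Section UnitriangularCoordinates.
Variables (G : groupType) (n : nat) (a : G -> 'M[int]_n).
Hypothesis aM : forall g h, a (g * h)%g = a g *m a h.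
Hypothesis a_unitriangular : forall g, lower_unitriangular (a g).
Hypothesis a_faithful : forall g, a g = 1%:M -> g = 1%g.

(* Entries are listed column by column: along this order each entry is additive
   on the subgroup where the previous ones vanish. *)
Definition position (ij : 'I_n * 'I_n) : nat := (ij.2 * n + ij.1)%N.

(** A sum of at most one term, which avoids decoding [k] into a pair of indices. *)
Definition coordinate k (g : G) : int :=
  \sum_(ij | position ij == k) (a g ij.1 ij.2 - (ij.1 == ij.2)%:R).

Lemma position_inj : injective position.
Proof.
move=> [i j] [i' j'] /eqP; rewrite /position /= => /eqP e.
have n_gt0 : (0 < n)%N by exact: leq_ltn_trans (ltn_ord i).
have jj : j = j' :> nat.
  have := congr1 (divn^~ n) e; rewrite !divnMDl// !divn_small ?addn0//.
have ii : i = i' :> nat by move: e; rewrite jj => /addnI.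
by congr pair; apply: val_inj.
Qed.

Lemma coordinateE i j g :
  coordinate (position (i, j)) g = a g i j - (i == j)%:R.
Proof.
rewrite /coordinate (big_pred1 (i, j))// => ij.
by apply/eqP/eqP => [/position_inj|->].
Qed.

Lemma chain_entry k g i j : chain coordinate k g -> (position (i, j) < k)%N ->
  a g i j = (i == j)%:R.
Proof. by move=> gk /gk /eqP; rewrite coordinateE subr_eq0 => /eqP. Qed.

(** In the entry [(i, j)] of the product, for [i > j], the terms [l = i] and [l = j] give the sum.
    Those with [l > i] vanish by triangularity, the others because [(l, j)] precedes [(i, j)] in its
    column. *)
Lemma coordinateM k g h : chain coordinate k g -> chain coordinate k h ->
  coordinate k (g * h)%g = coordinate k g + coordinate k h.
Proof.
move=> gk hk; case: (pickP (fun ij => position ij == k)) => [[i j] /eqP ijk|k0]; last first.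
  by rewrite /coordinate !big_pred0// addr0.
rewrite -ijk !coordinateE; have [ij|ji] := leqP i j.
  by rewrite !a_unitriangular// !subrr.
have /negPf ijF : i != j by apply: contraTneq ji => ->; rewrite ltnn.
rewrite ijF !subr0 aM mxE (bigD1 i)//= a_unitriangular// eqxx mul1r.
rewrite (bigD1 j)/= 1?eq_sym ?ijF// [a h j j]a_unitriangular// eqxx mulr1.
rewrite big1 ?addr0 1?addrC// => l /andP[li lj].
have [il|li'] := ltnP i l.
  by rewrite a_unitriangular ?(ltnW il)// eq_sym (negPf li) mul0r.
rewrite (chain_entry hk) ?(negPf lj) ?mulr0//.
by rewrite -ijk /position /= ltn_add2l ltn_neqAle li' andbT.
Qed.

Lemma coordinate_faithful g : chain coordinate (n * n) g -> g = 1%g.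
Proof.
move=> gn; apply: a_faithful; apply/matrixP => i j; rewrite mxE.
rewrite (chain_entry gn)// /position /=.
apply: (@leq_trans (j.+1 * n)%N); last by rewrite leq_mul2r ltn_ord orbT.
by rewrite mulSn addnC ltn_add2r.
Qed.

End UnitriangularCoordinates.

Lemma diff_sum (T : Type) (F : pzRingType) (V : lmodType F) n
    (c : (nat -> T) -> V) (g : nat -> T) :
  \sum_(j < n.+1) (-1) ^+ j *: c (fun k => g (bump j k)) = diff n c g.
Proof.
elim: n c g => [|n IHn] c g.
  by rewrite big_ord1 expr0 scale1r; congr c.
rewrite big_ord_recl expr0 scale1r [RHS]/=; congr (_ + _).
rewrite -IHn -sumrN; apply: eq_bigr => j _; rewrite exprS mulN1r scaleNr.
congr (- (_ *: c _)); apply/funext => -[|k] //.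
by rewrite /ftail /= /bump /= addnS.
Qed.

Lemma padic_int_dvd (p : prime_number) s (m : int) :
  pball s (rat_to_padic p m%:~R) -> ((p ^ s)%N %| m)%Z.
Proof.
rewrite rmorph_int => -[_ [y _ <-]].
rewrite -(rmorph_int (@FracField.tofrac (padic_int p))).
rewrite -(rmorph_nat (@FracField.tofrac (padic_int p))) -rmorphXn -rmorphM.
move=> /eqP; rewrite tofrac_eq => /eqP /(congr1 (fun x : padic_int p => x s)).
rewrite -natrX /= padic_natE padic_intE.
have -> : (p ^ s)%N%:Z = p%:Z ^+ s by rewrite -!natz natrX.
by rewrite modzz mul0r mod0z => /dvdz_mod0P.
Qed.

Section OrdinalCochains.
Variables (F : pzRingType) (G : groupType) (V : lmodType F).

Definition to_seq i (c : cochain G V i) : (nat -> G) -> V :=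
  fun g => c (fun k : 'I_i.+1 => g k).

Definition of_seq i (c : (nat -> G) -> V) : cochain G V i :=
  fun x => c (fun k => x (inord k)).

Lemma depends_on_to_seq i (c : cochain G V i) : depends_on i.+1 (to_seq c).
Proof. by move=> g g' gg'; congr c; apply/funext => k; exact: gg'. Qed.

Lemma to_seqK i (c : cochain G V i) : of_seq (to_seq c) = c.
Proof. by apply/funext => x; congr c; apply/funext => k; rewrite inord_val. Qed.

Lemma of_seqK i (c : (nat -> G) -> V) : depends_on i.+1 c ->
  to_seq (of_seq c : cochain G V i) = c.
Proof.
by move=> ci; apply/funext => g; apply: ci => k ki; rewrite inordK.
Qed.

Lemma to_seq_inj i (c d : cochain G V i) : to_seq c =1 to_seq d -> c = d.
Proof. by move=> /funext cd; rewrite -[c]to_seqK cd to_seqK. Qed.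

Lemma to_seq_coboundary i (c : cochain G V i) g :
  to_seq (coboundary c) g = diff i.+1 (to_seq c) g.
Proof. by rewrite -diff_sum. Qed.

End OrdinalCochains.

Lemma inj_surj_bijective (A B : Type) (f : A -> B) :
  injective f -> (forall y, exists x, f x = y) -> bijective f.
Proof.
move=> f_inj /choice[g fg]; exists g => // x; apply: f_inj; exact: fg.
Qed.

Section Comparison.
Variables (G : groupType) (K : preTopologicalGroupType).
Variables (phi : {multiplicative G -> K}) (F : pzRingType) (V : lmodType F).
Variables (rho : representation K V) (U : nat -> set K).
Hypothesis U1 : forall s, U s 1%g.
Hypothesis UM : forall s u v, U s u -> U s v -> U s (u * v)%g.
Hypothesis UV : forall s u, U s u -> U s (u^-1)%g.
Hypothesis UJ : forall s u x, U s u -> U s (x^-1 * u * x)%g.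
Hypothesis U_mono : forall s s' u, (s <= s')%N -> U s' u -> U s u.
Hypothesis U_nbhs : forall s (x : K), nbhs x [set y | U s (x^-1 * y)%g].
Hypothesis U_base : forall (x : K) A, nbhs x A ->
  exists s, forall y, U s (x^-1 * y)%g -> A y.
Hypothesis K_compact : compact [set: K].
Hypothesis phi_dense : forall s x, exists g, U s (x^-1 * phi g)%g.
Hypothesis rho_smooth : smooth rho.
Hypothesis acyc : forall b, acyclic (actG phi rho) (locally_constant U b.+1) setT.

Local Notation Ccts := (continuous_equivariant_cochains rho).
Local Notation Cdisc := (equivariant_cochains (pullback_rep phi rho)).

Let US s u : U s.+1 u -> U s u. Proof. exact: U_mono. Qed.
Let U_finite := compact_finite_cosets U_nbhs K_compact.
Let rho_uniform := smooth_uniform U_base rho_smooth.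

Lemma continuous_to_seq i (c : cochain K V i) :
  continuous_cochain c <-> locally_constant U i.+1 (to_seq c).
Proof.
rewrite (continuous_cochain_uniform UM U_mono U_nbhs U_base K_compact).
split=> -[s cs]; exists s => x y xy; first by apply: cs => k; exact: xy.
rewrite -[c]to_seqK; apply: cs => k _; exact: xy.
Qed.

Lemma equivariant_to_seq i (c : cochain K V i) :
  equivariant rho c <-> forall k, twist (fun k v => rho k v) k (to_seq c) = to_seq c.
Proof.
split=> [ce k|cK h g].
  apply/funext => x; rewrite /twist.
  rewrite -[to_seq c (gmul _ _)]/(c (fun j : 'I_i.+1 => k^-1 * x j)%g) ce.
  by rewrite -rep_actM mulgV rep_act1.
rewrite -[c]to_seqK /of_seq.
rewrite -[LHS]/(to_seq c (gmul h (fun k => g (inord k)))) -[in LHS](cK h) /twist.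
by rewrite gmulA mulVg gmul1.
Qed.

Lemma equivariant_to_seq_gcochain i (c : cochain G V i) :
  equivariant (pullback_rep phi rho) c <-> gcochain phi rho i.+1 (to_seq c).
Proof.
split=> [ce|[_ _ ce] h g]; first by split=> //; [exact: depends_on_to_seq|move=> h _ g; exact: ce].
by rewrite -[c]to_seqK /of_seq; exact: ce.
Qed.

Lemma to_seq_res i (c : cochain K V i) g :
  to_seq (res_cochain phi c) g = to_seq c (phi \o g).
Proof. by []. Qed.

Lemma restriction_surj i (x : group_cohomology (pullback_rep phi rho) i) :
  exists y, restriction phi rho i y = x.
Proof.
have [c ->] := cohomology_class_repr x.
have /asboolP[ce c0] := valP c.
have [|w [y [Mw wK w0 yg [cE y0]]]] := cocycle_extend U1 UV UJ US U_finite
    phi_dense rho_uniform acyc ((equivariant_to_seq_gcochain _).1 ce).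
  by move=> g; rewrite -to_seq_coboundary c0.
have wdep := locally_constant_depends U1 Mw.
pose d : cochain K V i := of_seq w.
have dw : to_seq d = w by exact: of_seqK.
have dC : d \in is_cocycle Ccts (i := i).
  apply/asboolP; split; last first.
    by apply: to_seq_inj => g; rewrite to_seq_coboundary dw w0.
  by split; [apply/continuous_to_seq; rewrite dw|apply/equivariant_to_seq; rewrite dw].
exists (cohomology_class (Cocycle dC)); rewrite restriction_class.
apply/esym/cohomology_class_eqP => /=.
(* In degree 0 the two cocycles must be equal, which [y0] provides. *)
case: i x c ce c0 w y Mw wK w0 yg cE y0 wdep d dw dC => [|i] x c ce c0 w y Mw wK w0 yg cE y0 wdep d dw dC.
  apply: to_seq_inj => g; rewrite -[LHS]/(to_seq (val c) g - to_seq (res_cochain phi d) g).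
  by rewrite to_seq_res dw cE y0// diff0 addr0 subrr.
have ydep := adapted_dep yg.
exists (of_seq y).
  by apply/equivariant_to_seq_gcochain; rewrite of_seqK.
apply: to_seq_inj => g; rewrite to_seq_coboundary of_seqK//.
rewrite -[RHS]/(to_seq (val c) g - to_seq (res_cochain phi d) g).
by rewrite to_seq_res dw cE addrC addKr.
Qed.

Lemma is_coboundary_res_inv i (c : cocycle Ccts i) :
  is_coboundary Cdisc (res_cochain phi (val c)) -> is_coboundary Ccts (val c).
Proof.
have /asboolP[[/continuous_to_seq Mc /equivariant_to_seq cK] c0] := valP c.
move: (val c) Mc cK c0 => {}c Mc cK c0; case: i c Mc cK c0 => [|i] c Mc cK c0 /=.
  move=> rc0; apply: to_seq_inj; apply: (degree0_inj phi_dense Mc) => g.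
  by rewrite -to_seq_res rc0.
move=> [z /equivariant_to_seq_gcochain zg zc].
have [||e [Me eK ce]] := coboundary_extend U1 UV UJ US U_finite
    phi_dense rho_uniform acyc Mc cK _ zg.
- by move=> x; rewrite -to_seq_coboundary c0.
- by move=> g; rewrite -to_seq_res -zc to_seq_coboundary.
have edep := locally_constant_depends U1 Me.
exists (of_seq e).
  by split; [apply/continuous_to_seq|apply/equivariant_to_seq]; rewrite of_seqK.
by apply: to_seq_inj => x; rewrite to_seq_coboundary of_seqK.
Qed.

Lemma restriction_inj i : injective (@restriction _ _ _ _ phi rho i).
Proof.
move=> x y.
have [c ->] := cohomology_class_repr x; have [d ->] := cohomology_class_repr y.
rewrite !restriction_class => /cohomology_class_eqP cd; apply/cohomology_class_eqP.
exact: (@is_coboundary_res_inv i (c - d)).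
Qed.

Theorem restriction_bijective i : bijective (restriction phi rho i).
Proof. by apply: inj_surj_bijective; [exact: restriction_inj|exact: restriction_surj]. Qed.

End Comparison.

Theorem theorem2p14
  (n : nat) (N : linear_algebraic_group n)
  (N_unipotent : unipotent N)
  (p : prime_number)
  (Gamma : subgroup (GL n rat))
  (Gamma_congruence : congruence_subgroup N Gamma)
  (K : subgroup (GL n (padic p)))
  (K_closure : subgroup_set K = padic_closure N Gamma p)
  (V : lmodType 'F_p)
  (rho : representation K V)
  (rho_smooth : smooth rho)
  (i : nat) :
  bijective (restriction (to_closure Gamma_congruence K_closure) rho i).
Proof.
have p_prime : prime p := valP p.
have [K' [K'N K'_compact _ GE]] := Gamma_congruence.
pose S : set 'M[rat]_n := [set GL_mx g | g in subgroup_set Gamma].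
have S_mul g h : S g -> S h -> S (g *m h).
  move=> [x Gx <-] [y Gy <-]; exists (x * y)%g => //; exact: subgroupM.
have S_unipotent g : S g -> exists k, (g - 1%:M) ^+ k = 0.
  move=> [x + <-]; rewrite GE => -[Nx _]; exact: unipotent_rational N_unipotent Nx.
have S_den : common_denominator S.
  have [D D_gt0 DP] := compact_common_denominator K'_compact.
  exists D => // _ [x + <-]; rewrite GE => -[_ K'x]; apply: DP; by exists x.
have [P P_unit PS] := unitriangular_integral S_mul S_unipotent S_den.
pose r2p := @rat_to_padic p.
pose Q := map_mx r2p P; pose Qi := map_mx r2p (invmx P).
have QQi : Q *m Qi = 1%:M by rewrite -map_mxM mulmxV// map_mx1.
have QiQ : Qi *m Q = 1%:M by rewrite -map_mxM mulVmx// map_mx1.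
have [C1 QC1] := map_rat_bounded p P; have [C2 QC2] := map_rat_bounded p (invmx P).
have QC := mbounded_mono (leq_maxl C1 C2) QC1.
have QiC := mbounded_mono (leq_maxr C1 C2) QC2.
(* The conjugated entries are integers, so [numq] loses nothing; this is [aE]. *)
pose a (g : Gamma) : 'M[int]_n := map_mx numq (P *m GL_mx (val g) *m invmx P).
have SG (g : Gamma) : S (GL_mx (val g)).
  by exists (val g) => //; exact: set_mem (valP g).
have aE g : map_mx intr (a g) = P *m GL_mx (val g) *m invmx P.
  have [_ aZ] := PS _ (SG g); apply/matrixP => i' j'; rewrite 2![in LHS]mxE.
  by have := aZ i' j'; rewrite Qint_def numqE => /eqP ->; rewrite mulr1.
have intr_mx_inj : injective (map_mx (intr : int -> rat) : 'M[int]_n -> 'M[rat]_n).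
  move=> b c /matrixP bc; apply/matrixP => i' j'; apply: (@intr_inj rat).
  by have := bc i' j'; rewrite !mxE.
have aM g h : a (g * h)%g = a g *m a h.
  apply: intr_mx_inj; rewrite map_mxM !aE.
  rewrite -[GL_mx (val (g * h)%g)]/(GL_mx (val g) *m GL_mx (val h)).
  by rewrite !mulmxA mulmxKV.
have a_unitriangular g : lower_unitriangular (a g).
  move=> i' j' ij; have [aL _] := PS _ (SG g); apply: (@intr_inj rat).
  by have /matrixP/(_ i' j') := aE g; rewrite mxE => ->; rewrite aL// mulrz_nat.
have a_faithful g : a g = 1%:M -> g = 1%g.
  move=> ag; have := aE g; rewrite ag map_mx1 => /esym Pg.
  have gE : GL_mx (val g) = invmx P *m (P *m GL_mx (val g) *m invmx P) *m P.
    by rewrite !mulmxA mulVmx// mul1mx mulmxKV.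
  by apply: val_inj; apply: val_inj; move: gE; rewrite Pg mulmx1 mulVmx.
pose phi := to_closure Gamma_congruence K_closure.
have conjQE (g : GL n rat) : conjQ Q Qi (map_mx r2p (GL_mx g)) =
    map_mx r2p (P *m GL_mx g *m invmx P).
  by rewrite /conjQ -!map_mxM.
have phiE (g : Gamma) : conjQ Q Qi (mx_of (phi g)) = map_mx r2p (map_mx intr (a g)).
  by rewrite aE -conjQE.
have conjQ_integral (g : GL n rat) : subgroup_set Gamma g ->
    mball 0 (conjQ Q Qi (GL_mx (GL_map r2p g))).
  move=> Gg i' j'; rewrite [GL_mx _]/= conjQE mxE; apply/pball_integers.
  have [_ gZ] := PS (GL_mx g) (ex_intro2 _ _ g Gg erefl).
  by have /intrP[m ->] := gZ i' j'; rewrite /r2p rmorph_int; exact: padic_integers_int.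
pose C := maxn C1 C2.
(* [Gamma] approximates [g] so closely that the error is still integral after conjugation, whence
   the precision [0 + C + C]. *)
have K_integral (g : K) : mball 0 (conjQ Q Qi (GL_mx (val g))).
  have [h Gh hg] := closure_approx K_closure g (0 + C + C)%N.
  have -> : GL_mx (val g) = GL_mx (GL_map r2p h) - (GL_mx (GL_map r2p h) - GL_mx (val g)).
    by rewrite opprB addrCA subrr addr0.
  rewrite conjQB; apply: mballD; first exact: conjQ_integral.
  by apply/mballN/(mball_conjQ QC QiC).
have phi_dense s (x : K) : exists g, filtration Q Qi s (x^-1 * phi g)%g.
  have [h Gh hx] := closure_approx K_closure x (s + C + C)%N.
  exists (Sub h (mem_set Gh)); apply: (filtration_coset QQi QiQ K_integral).
  exact: (mball_conjQ QC QiC).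
have U_nbhs := nbhs_filtration QQi QiQ QC QiC K_integral.
have U_base := filtration_nbhs QQi QiQ QC QiC K_integral.
have K_compact := subgroup_compact (closure_compact Gamma_congruence K_closure).
have U1 := filtration1 K QQi.
have UM := filtrationM QiQ K_integral.
have UV := filtrationV QQi QiQ K_integral.
have UJ := filtrationJ QQi QiQ K_integral.
have U_mono := @filtration_mono n p K Q Qi.
apply: (@restriction_bijective _ _ phi _ _ rho (filtration Q Qi)) => // b.
apply: (@acyclic_all _ _ phi p _ _ rho (filtration Q Qi) p_prime _ U1 UM UV UJ _ _ _
  (coordinate a) (n * n)%N).
- by move=> v; rewrite -scaler_nat (pcharf0 (pchar_Fp p_prime)) scale0r.
- by move=> s u; exact: U_mono.
- exact: compact_finite_cosets U_nbhs K_compact.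
- by move=> v; exact: (smooth_uniform U_base rho_smooth v).
- move=> k g h; exact: (@coordinateM Gamma n a aM a_unitriangular k g h).
(* By [phiE], [Ug] says that the entries of [a g - 1] are divisible by [p ^ s] in the p-adic
   integers, hence in the integers. *)
- move=> k s g Ug; rewrite /coordinate; apply: rpred_sum => -[i' j'] _ /=.
  apply: padic_int_dvd; have := Ug i' j'.
  rewrite phiE !mxE /r2p => Uij.
  by rewrite !rmorphB /= rmorph_nat rmorph_nat.
- move=> g; exact: (@coordinate_faithful Gamma n a a_faithful g).
Qed.
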